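(* Let $K$ be a field, $X=\{x_1,x_2,\ldots\}$ a finite or countable set, $P=K[X\times\mathbb{N}^*]$, $\sigma:P\to P$ the algebra endomorphism $x_i(j)\mapsto x_i(j+1)$, $S=P[s;\sigma]$ endowed with a monomial ordering $\prec$, and let $R\subset S$ be the subalgebra generated by the elements $x_i(1)s$. Let $I\subset R$ be a graded two-sided ideal and let $J\subset S$ be its extension, that is, the two-sided ideal of $S$ generated by $I$. If $G\subset J$ is a multi-homogeneous Gröbner basis of $J$, then $G\cap R$ is a homogeneous Gröbner basis of $I$.
   Context: $\mathbb{N}^*=\{1,2,\ldots\}$; $P$ is the commutative polynomial ring in the variables $x_i(j)=(x_i,j)$, and $S=P[s;\sigma]$ is the skew polynomial ring: the free left $P$-module with basis $\{s^i\}_{i\ge0}$ and multiplication determined by $sf=\sigma(f)s$ ($f\in P$). $S$ is graded by $S_i=Ps^i$, and $R$ by $R_i=R\cap S_i$ ($R$ is the image of the embedding $K\langle X\rangle\to S$, $x_i\mapsto x_i(1)s$). $\mathrm{Mon}(S)=\{ms^i\mid m \text{ a monomial of } P, i\ge0\}$ and $\mathrm{Mon}(R)=\mathrm{Mon}(S)\cap R$, a $K$-basis of $R$. A monomial ordering on $S$ is a total well-ordering $\prec$ of $\mathrm{Mon}(S)$ such that $v\prec w$ implies $pvq\prec pwq$ for all $v,w,p,q\in\mathrm{Mon}(S)$; it restricts to $\mathrm{Mon}(R)$. For nonzero $f\in S$, $\mathrm{lm}(f)$ is the $\prec$-largest monomial occurring in $f$; $\mathrm{lm}(G)=\{\mathrm{lm}(f)\mid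 f\in G,f\ne0\}$. A subset $G$ of a two-sided ideal $J$ of $S$ (resp. of $R$) is a Gröbner basis of $J$ if $\mathrm{lm}(G)$ and $\mathrm{lm}(J)$ generate the same two-sided ideal of $S$ (resp. of $R$). Multidegree: for a monomial $m=x_{i_1}(j_1)\cdots x_{i_d}(j_d)$ of $P$, $\partial(m)=(\mu_k)_{k\in\mathbb{N}^*}$ with $\mu_k=\#\{\alpha\mid j_\alpha=k\}$; with $P_\mu$ the span of monomials of multidegree $\mu$, the elements of the subspaces $P_\mu s^i$ of $S$ are called multi-homogeneous. A set is called multi-homogeneous (resp. homogeneous) if all its elements are. *)

(* Defs.v *)
From HB Require Import structures.
From mathcomp Require Import all_boot all_order all_algebra.
From mathcomp Require Import finmap monalg.
From mathcomp Require Import boolp classical_sets.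

Set Implicit Arguments.
Unset Strict Implicit.
Unset Printing Implicit Defensive.

Import GRing.Theory.

Local Open Scope ring_scope.
Local Open Scope classical_set_scope.

(* The skew polynomial ring P[s; sigma]: the element sum_i f_i s^i is stored  *)
(* as the sequence (f_i)_i, and wrapped in a record so that the commutative   *)
(* product of {poly P} is not inferred on it.                                 *)
Record skew_poly (P : nzRingType) (sigma : {rmorphism P -> P}) : predArgType :=
  SkewPoly { skew_val :> {poly P} }.

Section SkewPoly.
Variables (P : nzRingType) (sigma : {rmorphism P -> P}).

Local Notation skew_poly := (skew_poly sigma).
Local Notation SkewPoly := (@SkewPoly P sigma).

HB.instance Definition _ := [isNew for @skew_val P sigma].
HB.instance Definition _ := [Choice of skew_poly by <:].

Implicit Types f g h : skew_poly.

Lemma skewP f g : (forall i, f`_i = g`_i) <-> f = g.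
Proof. by split=> [fg|-> //]; apply/val_inj/polyP. Qed.

Definition skew_zero := SkewPoly 0.
Definition skew_opp f := SkewPoly (- skew_val f).
Definition skew_add f g := SkewPoly (skew_val f + skew_val g).
Definition skew_scale (a : P) f := SkewPoly (a *: skew_val f).

Fact skew_addA : associative skew_add.
Proof. by move=> f g h; apply: val_inj; rewrite /= addrA. Qed.
Fact skew_addC : commutative skew_add.
Proof. by move=> f g; apply: val_inj; rewrite /= addrC. Qed.
Fact skew_add0 : left_id skew_zero skew_add.
Proof. by move=> f; apply: val_inj; rewrite /= add0r. Qed.
Fact skew_addN : left_inverse skew_zero skew_opp skew_add.
Proof. by move=> f; apply: val_inj; rewrite /= addNr. Qed.

HB.instance Definition _ := GRing.isZmodule.Build skew_poly
  skew_addA skew_addC skew_add0 skew_addN.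

Fact skew_scaleA a b f : skew_scale a (skew_scale b f) = skew_scale (a * b) f.
Proof. by apply: val_inj; rewrite /= scalerA. Qed.
Fact skew_scale1 : left_id 1 skew_scale.
Proof. by move=> f; apply: val_inj; rewrite /= scale1r. Qed.
Fact skew_scaleDr : right_distributive skew_scale +%R.
Proof. by move=> a f g; apply: val_inj; rewrite /= scalerDr. Qed.
Fact skew_scaleDl f : {morph skew_scale^~ f : a b / a + b}.
Proof. by move=> a b; apply: val_inj; rewrite /= scalerDl. Qed.

HB.instance Definition _ := GRing.Zmodule_isLmodule.Build P skew_poly
  skew_scaleA skew_scale1 skew_scaleDr skew_scaleDl.

Lemma coef_skewD f g i : (f + g)`_i = f`_i + g`_i.
Proof. exact: coefD. Qed.
Lemma coef_skewZ a f i : (a *: f)`_i = a * f`_i.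
Proof. exact: coefZ. Qed.

(* The bilinear extension of (a s^i) (b s^j) = a sigma^i(b) s^(i + j).        *)
Definition skew_one := SkewPoly 1.
Definition skew_mul f g := SkewPoly
  (\poly_(n < (size f + size g).-1)
     \sum_(i < n.+1) f`_i * iter i sigma g`_(n - i)).

Fact iter_sigma0 i : iter i sigma 0 = 0.
Proof. by elim: i => //= i ->; rewrite rmorph0. Qed.
Fact iter_sigma1 i : iter i sigma 1 = 1.
Proof. by elim: i => //= i ->; rewrite rmorph1. Qed.
Fact iter_sigmaD i : {morph iter i sigma : a b / a + b}.
Proof. by elim: i => [|i IHi] a b; rewrite // !iterS IHi rmorphD. Qed.
Fact iter_sigmaM i : {morph iter i sigma : a b / a * b}.
Proof. by elim: i => [|i IHi] a b; rewrite // !iterS IHi rmorphM. Qed.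

Fact coef_skew_mul f g n :
  (skew_mul f g)`_n = \sum_(i < n.+1) f`_i * iter i sigma g`_(n - i).
Proof.
rewrite coef_poly; case: ltnP => // le_fg_n; rewrite big1 // => i _.
have [le_f_i|lt_i_f] := leqP (size f) i; first by rewrite nth_default ?mul0r.
rewrite [g`_ _]nth_default ?iter_sigma0 ?mulr0 //.
rewrite -(leq_add2l i) subnKC; last by rewrite -ltnS.
rewrite (leq_trans _ le_fg_n) // -ltnS.
by case: (size f) lt_i_f => // m le_i_m; rewrite addSn /= ltnS leq_add2r -ltnS.
Qed.

Fact skew_mulA : associative skew_mul.
Proof.
move=> f g h; apply/skewP => n; rewrite !coef_skew_mul.
pose F (i k : nat) := f`_i * (iter i sigma g`_(k - i) * iter k sigma h`_(n - k)).
transitivity (\sum_(i < n.+1) \sum_(k < n.+1 | (i <= k)%N) F i k).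
  apply: eq_bigr => -[i /= lt_in] _; rewrite coef_skew_mul.
  rewrite (big_morph _ (iter_sigmaD i) (iter_sigma0 i)) mulr_sumr.
  have -> : \sum_(k < n.+1 | (i <= k)%N) F i k =
            \sum_(j < (n - i).+1) F i (j + i)%N.
    rewrite -subSn // -(big_mkord predT (fun j => F i (j + i)%N)).
    by rewrite -{1}[i]add0n -(big_addn 0 n.+1 i predT (F i)) big_geq_mkord.
  apply: eq_bigr => j _; rewrite iter_sigmaM -iterD.
  by rewrite /F addnK [(i + j)%N]addnC subnDA subnAC.
rewrite (exchange_big_dep predT) //=; apply: eq_bigr => -[k /= lt_kn] _.
rewrite coef_skew_mul mulr_suml (@big_ord_narrow_leq _ _ _ k n _ lt_kn).
by apply: eq_bigr => i _; rewrite /F /= mulrA.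
Qed.

Fact skew_mul1 : left_id skew_one skew_mul.
Proof.
move=> f; apply/skewP => n; rewrite coef_skew_mul big_ord_recl /= subn0 coef1.
by rewrite mul1r big1 ?addr0 // => i _; rewrite coef1 mul0r.
Qed.

Fact skew_mulr1 : right_id skew_one skew_mul.
Proof.
move=> f; apply/skewP => n; rewrite coef_skew_mul big_ord_recr /= subnn coef1.
rewrite iter_sigma1 mulr1 big1 ?add0r // => i _.
by rewrite coef1 subn_eq0 leqNgt ltn_ord iter_sigma0 mulr0.
Qed.

Fact skew_mulDl : left_distributive skew_mul +%R.
Proof.
move=> f g h; apply/skewP => n; rewrite coef_skewD !coef_skew_mul -big_split.
by apply: eq_bigr => i _; rewrite coef_skewD mulrDl.
Qed.

Fact skew_mulDr : right_distributive skew_mul +%R.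
Proof.
move=> f g h; apply/skewP => n; rewrite coef_skewD !coef_skew_mul -big_split.
by apply: eq_bigr => i _; rewrite coef_skewD iter_sigmaD mulrDr.
Qed.

Fact skew_one_neq0 : skew_one != 0.
Proof. by rewrite -(inj_eq val_inj) oner_neq0. Qed.

HB.instance Definition _ := GRing.Zmodule_isNzRing.Build skew_poly
  skew_mulA skew_mul1 skew_mulr1 skew_mulDl skew_mulDr skew_one_neq0.

Lemma coef_skewM f g n :
  (f * g)`_n = \sum_(i < n.+1) f`_i * iter i sigma g`_(n - i).
Proof. exact: coef_skew_mul. Qed.

Fact skew_scaleAl (a : P) f g : a *: (f * g) = (a *: f) * g.
Proof.
apply/skewP => n; rewrite coef_skewZ !coef_skewM mulr_sumr.
by apply: eq_bigr => i _; rewrite coef_skewZ mulrA.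
Qed.

HB.instance Definition _ := GRing.Lmodule_isLalgebra.Build P skew_poly
  skew_scaleAl.

Definition skewX : skew_poly := SkewPoly 'X.

Lemma coef_skewX n : skewX`_n = (n == 1)%:R.
Proof. exact: coefX. Qed.

Lemma skew_comm (a : P) : skewX * a%:A = sigma a *: skewX.
Proof.
have coefA b n : (b%:A : skew_poly)`_n = b *+ (n == 0).
  by rewrite coef_skewZ coef1 mulr_natr.
apply/skewP => n; rewrite coef_skewM coef_skewZ coef_skewX.
case: n => [|n]; first by rewrite big_ord1 coef_skewX mul0r mulr0.
rewrite 2!big_ord_recl !coef_skewX mul0r add0r mul1r coefA big1 => [|i _].
  rewrite addr0 eqSS subn1 /=.
  case: n => [|n]; first by rewrite mulr1.
  by rewrite mulr0n rmorph0 mulr0.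
by rewrite coef_skewX mul0r.
Qed.

Lemma coef_skewXn i n : (skewX ^+ i)`_n = (n == i)%:R.
Proof.
elim: i n => [|i IHi] n; first by rewrite expr0 [LHS]coef1.
rewrite exprS coef_skewM; case: n => [|n].
  by rewrite big_ord1 coef_skewX mul0r.
rewrite 2!big_ord_recl !coef_skewX mul0r add0r mul1r big1 => [|j _].
  rewrite addr0 IHi /bump /= subn1 /= eqSS.
  by case: eqP => _; rewrite ?rmorph1 ?rmorph0.
by rewrite coef_skewX mul0r.
Qed.

Lemma skew_expand f : f = \sum_(i < size f) f`_i *: skewX ^+ i.
Proof.
apply/skewP => n.
rewrite (big_morph (fun g : skew_poly => g`_n) (id1 := 0) (op1 := +%R));
  [|by move=> g h; rewrite coef_skewD|exact: coef0].
under eq_bigr => i _ do rewrite coef_skewZ coef_skewXn mulr_natr.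
have [lt_n|le_n] := ltnP n (size f).
  rewrite (bigD1 (Ordinal lt_n)) //= eqxx big1 ?addr0 // => i.
  by rewrite -val_eqE /= eq_sym => /negbTE->.
rewrite nth_default // big1 // => i _.
by rewrite gtn_eqF // (leq_trans (ltn_ord i)).
Qed.

End SkewPoly.

(* N^* = {1, 2, ...}.                                                         *)
Definition posn : predArgType := {j : nat | (0 < j)%N}.
HB.instance Definition _ := Countable.on posn.

Definition pos1 : posn := Sub 1%N isT.
Definition posS (j : posn) : posn := Sub (val j).+1 isT.

(* The value of a commutative monomial at the family e of ring elements.      *)
Section MonomialEval.
Variables (I : choiceType) (A : comNzRingType) (e : I -> A).

Definition monom_eval (m : {cmonom I}) : A := \prod_(v <- finsupp m) e v ^+ m v.

Fact monom_evalEw (d : {fset I}) (m : {cmonom I}) :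
  fsubset (finsupp m) d -> monom_eval m = \prod_(v <- d) e v ^+ m v.
Proof.
move=> le_md; rewrite /monom_eval (big_fset_incl _ le_md) // => v _.
by rewrite -cmE_eq0 => /eqP->.
Qed.

Fact monom_eval_mmorphism : mmorphism monom_eval.
Proof.
split=> [m1 m2|]; last by rewrite /monom_eval mdom1 big_seq_fset0.
rewrite (@monom_evalEw (finsupp m1 `|` finsupp m2)%fset m1) ?fsubsetUl //.
rewrite (@monom_evalEw (finsupp m1 `|` finsupp m2)%fset m2) ?fsubsetUr //.
rewrite -big_split /monom_eval mdomD /=.
by apply: eq_bigr => v _; rewrite cmM exprD.
Qed.

HB.instance Definition _ :=
  isMultiplicative.Build {cmonom I} A monom_eval monom_eval_mmorphism.

Lemma monom_evalU v : monom_eval (ucm v) = e v.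
Proof. by rewrite /monom_eval mdomU big_seq_fset1 cmUU expr1. Qed.

End MonomialEval.

Section TwoSidedIdeals.
Variable S : nzRingType.
Implicit Types A B J : set S.

(* Two-sided ideals of a subring A of S, as subsets of S; A = setT gives the  *)
(* two-sided ideals of S itself.                                              *)
Definition two_sided_ideal A J : Prop :=
  [/\ J `<=` A, J 0, forall f g, J f -> J g -> J (f + g) &
      forall a f, A a -> J f -> J (a * f) /\ J (f * a)].

Definition ideal_gen A B : set S := smallest (two_sided_ideal A) B.

End TwoSidedIdeals.

(* P = K[X x N^*] is lpoly, sigma is shift, S = P[s; sigma] is lskew and its  *)
(* subalgebra R is Rsub; a countType is a finite or countable set.            *)
Definition lpoly (K : fieldType) (X : countType) :=
  {malg K[{cmonom (X * posn)%type}]}.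
HB.instance Definition _ K X := GRing.ComAlgebra.on (lpoly K X).

Section Letterplace.
Variables (K : fieldType) (X : countType).

Local Notation P := (lpoly K X).
Local Notation monom := {cmonom (X * posn)%type}.

Definition lvar (i : X) (j : posn) : P := << ucm (i, j) >>.

Definition shift : P -> P :=
  mmap (malgC : K -> P) (monom_eval (fun v => lvar v.1 (posS v.2))).
HB.instance Definition _ := GRing.RMorphism.copy shift
  (mmap (malgC : K -> P) (monom_eval (fun v => lvar v.1 (posS v.2)))).

Lemma shift_const (c : K) : shift c%:MP = c%:MP.
Proof. by rewrite /shift mmapC. Qed.

Lemma shift_var i j : shift (lvar i j) = lvar i (posS j).
Proof. by rewrite /shift mmapU monom_evalU mul1r. Qed.

Definition lskew := skew_poly shift.
HB.instance Definition _ := GRing.Lalgebra.on lskew.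

Local Notation S := lskew.
Local Notation s := (skewX shift : S).

(* K-subalgebras of S, where K acts through the constants of P.               *)
Definition subalgebra (A : set S) : Prop :=
  [/\ A 1, forall f g, A f -> A g -> A (f + g),
      forall f g, A f -> A g -> A (f * g) &
      forall (c : K) f, A f -> A (c%:MP *: f)].

Definition Rsub : set S :=
  smallest subalgebra [set f | exists i : X, f = lvar i pos1 *: s].

Definition Sdeg (i : nat) : set S := [set p *: s ^+ i | p in [set: P]].
Definition Rdeg (i : nat) : set S := Rsub `&` Sdeg i.

(* Every homogeneous component f_i s^i of an element f of J lies in J.        *)
Definition graded (J : set S) : Prop :=
  forall f, J f -> forall i, J (f`_i *: s ^+ i).

Definition smon (m : monom) (i : nat) : S := (<< m >> : P) *: s ^+ i.
Definition MonS : set S := [set w | exists m i, w = smon m i].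

(* Only the values of [prec] on MonS are relevant.                            *)
Definition monomial_ordering (prec : S -> S -> Prop) : Prop :=
  [/\ forall v, MonS v -> ~ prec v v,
      forall u v w, MonS u -> MonS v -> MonS w ->
        prec u v -> prec v w -> prec u w,
      forall v w, MonS v -> MonS w -> [\/ prec v w, v = w | prec w v],
      forall A : set S, A `<=` MonS -> A !=set0 ->
        exists2 v, A v & forall w, A w -> w <> v -> prec v w &
      forall v w p q, MonS v -> MonS w -> MonS p -> MonS q ->
        prec v w -> prec (p * v * q) (p * w * q)].

(* The monomial w has a nonzero coefficient in f.                             *)
Definition occurs (w f : S) : Prop :=
  exists m i, w = smon m i /\ (f`_i)@_m != 0.

Definition is_lm (prec : S -> S -> Prop) (f w : S) : Prop :=
  occurs w f /\ forall v, occurs v f -> v <> w -> prec v w.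

Definition lm_set (prec : S -> S -> Prop) (G : set S) : set S :=
  [set w | exists f, [/\ G f, f <> 0 & is_lm prec f w]].

(* Groebner bases of a two-sided ideal J of the subring A of S.               *)
Definition groebner_basis (prec : S -> S -> Prop) (A J G : set S) : Prop :=
  G `<=` J /\ ideal_gen A (lm_set prec G) = ideal_gen A (lm_set prec J).

Definition multideg (m : monom) (k : posn) : nat :=
  (\sum_(v <- finsupp m | v.2 == k) m v)%N.

(* The span of the monomials of multidegree mu.                               *)
Definition Pmulti (mu : posn -> nat) : set P :=
  [set p | forall m, m \in msupp p -> multideg m =1 mu].

Definition multi_homogeneous (G : set S) : Prop :=
  forall g, G g -> exists mu i, exists2 p, Pmulti mu p & g = p *: s ^+ i.

Definition homogeneous (G : set S) : Prop :=
  forall g, G g -> exists i, Rdeg i g.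

End Letterplace.

(* Main.v *)
(* Everything in J is a K-combination of products a s^i f b s^j with f in I
   homogeneous and a, b monomials, and the letters of f then occupy
   consecutive positions. Such a product is in R only if a s^i and b s^j can
   be replaced by words, so projecting onto R maps J to I, and J meets R in I.

   Let w in Mon(R) be the leading monomial of an element of I; then w = a s^i
   lm(g) b s^j for some g in G. If lm(g) is a word, g is in R by multi-
   homogeneity and a s^i, b s^j are words. Otherwise lm(g) = m s^d is made of
   runs of letters at consecutive positions <= d, separated by holes, and of
   letters at positions > d; we claim that some run is in lm(I). That run is a
   proper factor of w, and induction on the length of w concludes.

   For the claim, if a word r is not in lm(I), taking the coefficient of r in
   the normal form modulo I defines a linear functional which vanishes on I,
   is 1 on r, and vanishes on the words below r. If no run were in lm(I), the
   product of the functionals of all the runs, requiring the holes to be empty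
   and the letters beyond d to be those of m, would vanish on J, be 1 on
   lm(g), and vanish on the monomials below lm(g); but then it would not
   vanish on g. *)

Require Import Defs.
From HB Require Import structures.
From mathcomp Require Import all_boot all_order all_algebra.
From mathcomp Require Import finmap monalg zify ring.
From mathcomp Require Import boolp classical_sets.

Set Implicit Arguments.
Unset Strict Implicit.
Unset Printing Implicit Defensive.

Import GRing.Theory.

Local Open Scope ring_scope.
Local Open Scope classical_set_scope.

Local Notation "1" := (@mone _) : monom_scope.
Local Notation "m * a" := (mmul m a) : monom_scope.

(* Positions are counted from 0, so that [place 0] is 1 in N^*. *)
Definition place (k : nat) : posn := Sub k.+1 isT.

Lemma place_pred (j : posn) : place (val j).-1 = j.
Proof. by apply: val_inj; case: j => -[]. Qed.

Lemma place_inj : injective place.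
Proof. by move=> k l /(congr1 val) [->]. Qed.

Lemma place_eq k l : (place k == place l) = (k == l).
Proof. exact: (inj_eq place_inj). Qed.

Lemma cmonom_funE (I : choiceType) (d : {fset I}) (E : I -> nat) v :
  (E v != 0%N -> v \in d) -> [cmonom E v | v in d]%M v = E v.
Proof.
move=> Ed; rewrite cmE fsfunE; case: ifP => // /negbT vd.
by apply/esym/eqP; apply: contraNT vd.
Qed.

Lemma cmonom_ind (I : choiceType) (Q : {cmonom I} -> Prop) :
  Q 1%M -> (forall v m, Q m -> Q (ucm v * m)%M) -> forall m, Q m.
Proof.
move=> Q1 QM m; have [n] := ubnP (mdeg m); elim: n m => // n IHn m le_mn.
have [->//|m_neq1] := eqVneq m 1%M.
have [v m_v] : exists v, m v != 0%N.
  apply/not_existsP => m0; case/eqP: m_neq1; apply/eqP/cmP => v.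
  by rewrite cm1; apply/eqP/negPn/negP/m0.
have def_m : m = (ucm v * divcm m (ucm v))%M.
  apply/eqP/cmP => u; rewrite cmM divcmE cmU.
  case: eqP => [<-|_]; last by rewrite subn0.
  by rewrite subnKC // lt0n.
rewrite def_m; apply: QM; apply: IHn.
by move: le_mn; rewrite {1}def_m mdegM mdegU.
Qed.

(** * Monomials and words *)

Section Monomials.
Variable X : countType.
Local Notation monom := {cmonom (X * posn)%type}.
Implicit Types (m a b : monom) (x y : X) (i j k n : nat).

Lemma monomP m a : (forall x k, m (x, place k) = a (x, place k)) -> m = a.
Proof.
by move=> eq_ma; apply/eqP/cmP => -[x j]; rewrite -(place_pred j) eq_ma.
Qed.

(* [shm e] is sigma^e on monomials; [lom e] keeps the first e positions of a
   monomial and [him e] the others, moved back by e. *)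
Definition shm e m : monom :=
  [cmonom (if (e < val v.2)%N then m (v.1, place ((val v.2).-1 - e)) else 0%N)
     | v in [fset (v.1, place ((val v.2).-1 + e)) | v in finsupp m]%fset]%M.

Definition lom e m : monom :=
  [cmonom (if (val v.2 <= e)%N then m v else 0%N) | v in finsupp m]%M.

Definition him e m : monom :=
  [cmonom m (v.1, place ((val v.2).-1 + e))
     | v in [fset (v.1, place ((val v.2).-1 - e)) | v in finsupp m]%fset]%M.

Lemma shmE e m x k :
  shm e m (x, place k) = if (e <= k)%N then m (x, place (k - e)) else 0%N.
Proof.
rewrite /shm cmonom_funE /= ?ltnS //; case: ifP => // le_ek m_neq0.
apply/imfsetP; exists (x, place (k - e)); first by rewrite /= -cmE_neq0.
by rewrite /= subnK.
Qed.

Lemma lomE e m x k :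
  lom e m (x, place k) = if (k < e)%N then m (x, place k) else 0%N.
Proof.
by rewrite /lom cmonom_funE //=; case: ifP => // _; rewrite cmE_neq0.
Qed.

Lemma himE e m x k : him e m (x, place k) = m (x, place (k + e)).
Proof.
rewrite /him cmonom_funE //= => m_neq0.
apply/imfsetP; exists (x, place (k + e)); first by rewrite /= -cmE_neq0.
by rewrite /= addnK.
Qed.

Lemma ucmE x k y l : ucm (x, place k) (y, place l) = (x == y) && (k == l) :>
  nat.
Proof. by rewrite cmU xpair_eqE place_eq. Qed.

Lemma cm1E x k : (1%M : monom) (x, place k) = 0%N. Proof. exact: cm1. Qed.

Lemma monME m a x k :
  (m * a)%M (x, place k) = (m (x, place k) + a (x, place k))%N.
Proof. exact: cmM. Qed.

Definition monE := (shmE, lomE, himE, monME, cm1E, ucmE).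

Lemma shm0 m : shm 0 m = m.
Proof. by apply: monomP => x k; rewrite monE subn0. Qed.

Lemma shm1 e : shm e 1%M = 1%M.
Proof. by apply: monomP => x k; rewrite !monE if_same. Qed.

Lemma shmM e m a : shm e (m * a)%M = (shm e m * shm e a)%M.
Proof. by apply: monomP => x k; rewrite !monE; case: ifP. Qed.

Lemma shmD i j m : shm i (shm j m) = shm (i + j) m.
Proof.
apply: monomP => x k; rewrite !monE; have [le_ik|lt_ki] := leqP i k.
  by rewrite leq_subRL // subnDA.
by rewrite leqNgt (leq_trans lt_ki (leq_addr _ _)).
Qed.

Lemma shm_ucm e x k : shm e (ucm (x, place k)) = ucm (x, place (k + e)).
Proof.
apply: monomP => y l; rewrite !monE; case: (x == y) => /=;
  last by rewrite if_same.
case: ifP => [le_el|/negbT lt_le]; first by congr nat_of_bool; lia.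
by case: eqP => // def_l; lia.
Qed.

Lemma lo_hi e m : m = (lom e m * shm e (him e m))%M.
Proof.
apply: monomP => x k; rewrite !monE.
by case: ltnP => [_|le_ek]; rewrite ?addn0 ?subnK.
Qed.

(* Words with holes: [None] leaves its position empty. *)
Fixpoint omon (o : seq (option X)) : monom :=
  match o with
  | [::] => 1%M
  | Some x :: o' => (ucm (x, place 0) * shm 1 (omon o'))%M
  | None :: o' => shm 1 (omon o')
  end.

Lemma omonE o x k : omon o (x, place k) = (nth None o k == Some x) :> nat.
Proof.
elim: o k => [|[y|] o IHo] [|k]; rewrite /= ?nth_nil ?monE /= ?IHo ?subn1 //.
- by rewrite addn0 andbT.
- by rewrite andbF add0n.
Qed.

Definition wd (u : seq X) : monom := omon (map Some u).

Lemma omon_cat o o' : omon (o ++ o') = (omon o * shm (size o) (omon o'))%M.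
Proof.
apply: monomP => x k; rewrite !monE !omonE nth_cat.
case: ltnP => [_|le_ok]; first by rewrite addn0.
by rewrite [nth None o k]nth_default.
Qed.

Lemma wd_cat u v : wd (u ++ v) = (wd u * shm (size u) (wd v))%M.
Proof. by rewrite /wd map_cat omon_cat size_map. Qed.

Lemma wdE (u : seq X) x k : wd u (x, place k) = (onth u k == Some x) :> nat.
Proof. by rewrite omonE -onthE. Qed.

Lemma him_wd e (u : seq X) : wd (drop e u) = him e (wd u).
Proof.
by apply: monomP => x k; rewrite !monE !wdE !onthE map_drop nth_drop addnC.
Qed.

Lemma mulm_inj m : injective (mmul m).
Proof.
move=> a b eq_ab; apply: monomP => x k; apply: (@addnI (m (x, place k))).
by rewrite -!monME eq_ab.
Qed.

(** A word has exactly one letter at each of its places, so the letters of [u] are those of [v] from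
    place [i] on, and cancelling them leaves [a]. The bound on the lengths matters for an empty [u],
    which leaves no trace in the product. *)
Lemma wd_factor a i (u v : seq X) :
    (a * shm i (wd u))%M = wd v -> (i + size u <= size v)%N ->
  exists v1 v2, [/\ v = v1 ++ u ++ v2, size v1 = i &
                    a = (wd v1 * shm (i + size u) (wd v2))%M].
Proof.
move=> def_wv le_iuv; exists (take i v), (drop (i + size u) v).
have size_v1 : size (take i v) = i by rewrite size_takel //; lia.
have def_u : u = take (size u) (drop i v).
  (* The alphabet may be empty, so the default letter of [nth] is taken from [v]; when [v] is empty,
     so is [u]. *)
  have [v0|[x0 _]] : v = [::] \/ exists x : X, True.
  - by case: (v) => [|x ?]; [left|right; exists x].
  - by move: le_iuv; rewrite v0 /=; case: (u) => //=; lia.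
  apply: (@eq_from_nth _ x0) => [|k lt_ku].
    by rewrite size_takel // size_drop; lia.
  have lt_ikv : (i + k < size v)%N by apply: leq_trans le_iuv;
    rewrite ltn_add2l.
  rewrite nth_take // nth_drop;
    have := congr1 (fun m => m (nth x0 u k, place (i + k))) def_wv.
  rewrite !monE !wdE leq_addr addKn !onthE !(nth_map x0) //.
  by rewrite eqxx; case: eqP => [[->] |_] //; lia.
have def_v : v = take i v ++ u ++ drop (i + size u) v.
  by rewrite {1}def_u addnC -drop_drop !cat_take_drop.
split=> //; apply: (@mulm_inj (shm i (wd u))).
rewrite mulmC def_wv {1}def_v !wd_cat size_v1 shmM shmD.
by rewrite mulmA [X in (X * _)%M]mulmC -mulmA.
Qed.

(** A divisor of a word has at most one letter at each place, so its first [d] places form a word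
    with holes. *)
Lemma masked_omon m a d (v : seq X) :
    (m * a)%M = wd v ->
  exists2 o, size o = d & m = (omon o * shm d (him d m))%M.
Proof.
move=> def_wv.
have m_le x k : m (x, place k) = ((onth v k == Some x) && (m (x, place k) !=
  0%N)) :> nat.
  have := congr1 (fun m => m (x, place k)) def_wv; rewrite !monE wdE.
  by case: eqP => _; case: (m _) => [|[|n]] //=; lia.
pose F k := if onth v k is Some x then
  if m (x, place k) != 0%N then Some x else None else None.
exists (mkseq F d); first exact: size_mkseq.
apply: monomP => x k; rewrite !monE omonE.
have [le_dk|lt_kd] := leqP d k.
  by rewrite nth_default ?size_mkseq // subnK.
rewrite nth_mkseq // addn0 m_le /F; case: (onth v k) => [y|] //.
have [<-|ne_yx] := eqVneq y x.
  by rewrite eqxx; case: ifP => //; rewrite eqxx.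
have [/eqP|_] := eqVneq (Some y) (Some x).
  by rewrite (inj_eq Some_inj) (negbTE ne_yx).
by case: ifP => // _; rewrite (inj_eq Some_inj) (negbTE ne_yx).
Qed.

(** * Multidegrees *)

Lemma multideg_ge m x (j : posn) : (m (x, j) <= multideg m j)%N.
Proof.
have [->//|m_neq0] := eqVneq (m (x, j)) 0%N.
by rewrite /multideg (big_rem (x, j)) -?cmE_neq0 //= eqxx leq_addr.
Qed.

Lemma multideg_option m (j : posn) (ox : option X) :
  (forall y, m (y, j) = (ox == Some y) :> nat) -> multideg m j = isSome ox.
Proof.
case: ox => [x|] def_m; last by rewrite /multideg big1 // => -[y l] /= /eqP->.
rewrite /multideg (big_rem (x, j)) -?cmE_neq0 /= ?def_m ?eqxx //.
rewrite big_seq_cond big1 ?addn0 // => -[y l] /= /andP[+ /eqP def_l].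
rewrite {l}def_l mem_rem_uniq ?fset_uniq //.
rewrite !inE xpair_eqE eqxx andbT def_m => /andP[ne_yx _].
by rewrite (inj_eq Some_inj) eq_sym (negbTE ne_yx).
Qed.

Lemma multideg1 m (j : posn) :
  multideg m j = 1%N -> exists x, forall y, m (y, j) = (x == y) :> nat.
Proof.
move=> m1; have [x m_x] : exists x, m (x, j) != 0%N.
  apply/not_existsP => m0; move: m1;
    rewrite /multideg big1 // => -[y l] /= /eqP->.
  by apply/eqP/negPn/negP/m0.
exists x => y; move: m1; rewrite /multideg (big_rem (x, j)) -?cmE_neq0 //= eqxx.
have [<-|ne_xy] := eqVneq x y; first by move: m_x; case: (m (x, j)) => [|[|]].
move=> m1; apply/eqP/negPn/negP; rewrite cmE_neq0 => m_y.
have : (y, j) \in rem (x, j) (finsupp m).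
  by rewrite mem_rem_uniq ?fset_uniq // !inE xpair_eqE eq_sym (negbTE ne_xy).
rewrite -cmE_neq0 in m_y => y_rem; move: m1.
rewrite (big_rem _ y_rem) /= eqxx; move: m_x m_y.
by case: (m (x, j)) => [|[|?]]; case: (m (y, j)).
Qed.

(** Being a word of length n is a condition on the multidegree alone: one letter at each of the
    first n places and none beyond. This is what makes multi-homogeneity useful. *)
Lemma multideg_wd m (u : seq X) :
  multideg m =1 multideg (wd u) -> exists2 v, size v = size u & m = wd v.
Proof.
move=> eq_mu; have [F defF] : {F : nat -> option X & forall k,
    isSome (F k) = (k < size u)%N /\
    forall y, m (y, place k) = (F k == Some y) :> nat}.
  apply: (@choice _ _ (fun k ox => isSome ox = (k < size u)%N /\
    forall y, m (y, place k) = (ox == Some y) :> nat)) => k.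
  have := @multideg_option (wd u) (place k) (onth u k) (fun y => wdE u y k).
  rewrite -eq_mu -onthTE; case: (onth u k) => [z|] /= m_k.
    by have [x def_m] := multideg1 m_k; exists (Some x).
  exists None; split=> // y; have := multideg_ge m y (place k).
  by rewrite m_k; case: (m _).
pose v := pmap F (iota 0 (size u)).
have def_v : map Some v = mkseq F (size u).
  rewrite /v /mkseq; have: all (fun k => isSome (F k)) (iota 0 (size u)).
    by apply/allP => k; rewrite mem_iota (defF k).1.
  by elim: (iota 0 _) => //= k s IHs /andP[]; case: (F k) => //= x _ /IHs->.
exists v; first by rewrite -(size_map Some) def_v size_mkseq.
apply: monomP => y k; rewrite (defF k).2 /wd def_v omonE.
have [le_uk|lt_ku] := leqP (size u) k; last by rewrite nth_mkseq.
rewrite nth_default ?size_mkseq //.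
by have := (defF k).1; rewrite ltnNge le_uk; case: (F k).
Qed.

End Monomials.

(** * Linear functionals on S and monomial orderings *)

(* These are locked because conversion between two distinct elements of P or S
   unfolds their products and does not terminate in practice. *)
HB.lock Definition kscale (K : fieldType) (X : countType) (c : K)
  (f : lskew K X) : lskew K X := (c%:MP : lpoly K X) *: f.

HB.lock Definition mcf (K : fieldType) (X : countType) (f : lskew K X)
  (m : {cmonom (X * posn)%type}) (i : nat) : K := (f`_i)@_m.

HB.lock Definition mon (K : fieldType) (X : countType)
  (m : {cmonom (X * posn)%type}) (i : nat) : lskew K X := smon K m i.

HB.lock Definition sandwich (K : fieldType) (X : countType)
    (a : {cmonom (X * posn)%type}) (i : nat) (f : lskew K X)
    (b : {cmonom (X * posn)%type}) (j : nat) : lskew K X :=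
  mon K a i * f * mon K b j.

(** The K-linear functional on S with value [A m i] at [mon m i]; functionals are thus given by
    arbitrary functions on the monomials. *)
HB.lock Definition ext (K : fieldType) (X : countType)
    (A : {cmonom (X * posn)%type} -> nat -> K) (f : lskew K X) : K :=
  \sum_(i < size f) mmap idfun (A^~ i) (f`_i).

Section Letterplace.
Variables (K : fieldType) (X : countType).

Local Notation P := (lpoly K X).
Local Notation monom := {cmonom (X * posn)%type}.
Local Notation S := (lskew K X).
Local Notation mon := (@mon K X).
Implicit Types (f g h : S) (m a b : monom) (c : K) (i j k n : nat).

(** * Coefficients and monomials of S *)

Lemma monom_mul m a : (<< m >> : P) * << a >> = << (m * a)%M >>.
Proof.
transitivity (fgmul (<< m >> : {malg K[monom]}) << a >>);
  first exact: malgM_def.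
by have := @fgmulUU monom K 1 1 m a; rewrite mulr1.
Qed.

Lemma mcfE f m i : mcf f m i = (f`_i)@_m. Proof. by rewrite unlock. Qed.

Lemma coef_kscale c f i : (kscale c f)`_i = (c%:MP : P) * f`_i.
Proof. rewrite unlock; exact: coef_skewZ. Qed.

Lemma mcfP f g : (forall m i, mcf f m i = mcf g m i) -> f = g.
Proof.
by move=> eq_fg; apply/skewP => i; apply/malgP => m; have := eq_fg m i;
  rewrite !mcfE.
Qed.

Lemma mcf0 m i : mcf (0 : S) m i = 0.
Proof. by rewrite !mcfE [X in X@_m]coef0 mcoeff0. Qed.

Lemma mcfD f g m i : mcf (f + g) m i = mcf f m i + mcf g m i.
Proof. by rewrite !mcfE coef_skewD mcoeffD. Qed.

Lemma mcfN f m i : mcf (- f) m i = - mcf f m i.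
Proof. by rewrite !mcfE [X in X@_m]coefN mcoeffN. Qed.

Lemma mcfZ c f m i : mcf (kscale c f) m i = c * mcf f m i.
Proof. by rewrite !mcfE coef_kscale mcoeffCM. Qed.

Lemma mon_smon m i : mon m i = smon K m i.
Proof. by rewrite unlock. Qed.

Lemma coef_mon m i n : (mon m i)`_n = if n == i then << m >> : P else 0.
Proof.
by rewrite unlock coef_skewZ coef_skewXn; case: eqP; rewrite ?mulr1 ?mulr0.
Qed.

Lemma mcf_mon m i a n : mcf (mon m i) a n = ((m == a) && (n == i))%:R.
Proof.
rewrite [mcf _ _ _]mcfE coef_mon.
by case: eqP => _; rewrite ?mcoeffU1 ?andbT // mcoeff0 andbF.
Qed.

Lemma mon_inj m i a j : mon m i = mon a j -> m = a /\ i = j.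
Proof.
move/(congr1 (fun f => mcf f a j)); rewrite !mcf_mon !eqxx /=.
have [->|_] := eqVneq m a; have [->|_] := eqVneq j i => // /eqP.
all: by rewrite eq_sym oner_eq0.
Qed.

Lemma mcf_mon_neq0 m i a n : mcf (mon m i) a n != 0 -> m = a /\ i = n.
Proof.
by rewrite mcf_mon; case: (m =P a); case: (n =P i) => //=; rewrite eqxx.
Qed.

Lemma shift_monom m : shift (<< m >> : P) = << shm 1 m >>.
Proof.
rewrite /shift mmapU [X in X * _]mpolyC1E mul1r.
elim/cmonom_ind: m => [|[x j] m IHm]; first by rewrite mmorph1 shm1.
rewrite mmorphM [X in _ * X]IHm [X in X * _]monom_evalU shmM /= -[j in X in _ =
  X]place_pred shm_ucm.
have -> : place ((val j).-1 + 1) = posS j.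
  by apply: val_inj; case: j => -[|j] //= _; rewrite addn1.
exact: monom_mul.
Qed.

Lemma iter_shift_monom n m :
  iter n (@shift K X) (<< m >> : P) = << shm n m >>.
Proof.
elim: n => [|n IHn]; first by rewrite shm0.
rewrite iterS.
rewrite IHn.
rewrite shift_monom.
rewrite shmD.
rewrite add1n.
reflexivity.
Qed.

Lemma mon_mul m i a j : mon m i * mon a j = mon (m * shm i a)%M (i + j).
Proof.
apply/skewP => n; rewrite coef_skewM coef_mon.
under eq_bigr => k _ do rewrite !coef_mon.
have [le_in|lt_ni] := leqP i n; last first.
  rewrite ltn_eqF ?big1 // => [k _|];
    last exact: leq_trans lt_ni (leq_addr _ _).
  by rewrite ltn_eqF ?mul0r // (leq_ltn_trans _ lt_ni) // -ltnS.
have lt_in : (i < n.+1)%N by [].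
rewrite (bigD1 (Ordinal lt_in)) //= eqxx big1 ?addr0 => [|k].
  have -> : (n - i == j)%N = (n == i + j)%N by lia.
  case: eqP => _; last by rewrite iter_sigma0 mulr0.
  by rewrite iter_shift_monom monom_mul.
by rewrite -val_eqE /= => /negbTE->; rewrite mul0r.
Qed.

Lemma iter_shift_const n c : iter n (@shift K X) (c%:MP : P) = c%:MP.
Proof. by elim: n => //= n ->; rewrite shift_const. Qed.

Lemma kscaleAl c f g : kscale c f * g = kscale c (f * g).
Proof.
apply/skewP => n; rewrite [RHS]coef_kscale [LHS]coef_skewM [X in _ *
  X]coef_skewM mulr_sumr.
by apply: eq_bigr => i _; rewrite coef_kscale mulrA.
Qed.

Lemma kscaleAr c f g : f * kscale c g = kscale c (f * g).
Proof.
apply/skewP => n; rewrite [RHS]coef_kscale [LHS]coef_skewM [X in _ *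
  X]coef_skewM mulr_sumr.
apply: eq_bigr => i _; rewrite coef_kscale iter_sigmaM iter_shift_const.
by rewrite mulrCA.
Qed.

Lemma lskew_mulA f g h : f * (g * h) = f * g * h.
Proof. exact: mulrA. Qed.

Lemma lskew_mulDl f g h : (f + g) * h = f * h + g * h.
Proof. exact: mulrDl. Qed.

Lemma lskew_mulDr f g h : f * (g + h) = f * g + f * h.
Proof. exact: mulrDr. Qed.

Lemma kscale0 f : kscale 0 f = 0.
Proof. by apply: mcfP => m i; rewrite mcfZ mul0r mcf0. Qed.

Lemma kscaleN1 f : kscale (- 1) f = - f.
Proof. by apply: mcfP => m i; rewrite mcfZ mulN1r mcfN. Qed.

Lemma mon1 : mon 1%M 0 = 1 :> S.
Proof. apply: mcfP => m i; rewrite mcf_mon mcfE [X in X@_m]coef1.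
by case: i => [|i]; rewrite /= ?andbT ?andbF ?mcoeff1 1?eq_sym // mcoeff0. Qed.

(** Induction over the terms of [f]. Since only monomials that occur in [f] are considered, a linear
    identity can be checked on the support of [f]. *)
Lemma skew_span (Q : S -> Prop) f :
    Q 0 -> (forall g h, Q g -> Q h -> Q (g + h)) ->
    (forall m i, mcf f m i != 0 -> Q (kscale (mcf f m i) (mon m i))) ->
  Q f.
Proof.
move=> Q0 QD Qf; rewrite [f]skew_expand.
elim/big_ind: _ => // -[i /= _] _.
rewrite [f`_i]monalgE scaler_suml big_seq; elim/big_ind: _ => // m m_f.
have := Qf m i; rewrite mcfE mcoeff_neq0 => /(_ m_f); congr Q.
apply/skewP => n; rewrite coef_kscale coef_mon coef_skewZ coef_skewXn.
case: (n == i); last by rewrite mulr0n [LHS]mulr0 [RHS]mulr0.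
rewrite mulr1n [RHS]mulr1.
transitivity (fgmul ((mcoeff m f`_i)%:MP : {malg K[monom]}) << m >>).
  exact: malgM_def.
by have := @fgmulUU monom K (mcoeff m f`_i) 1 1%M m; rewrite mulr1 mul1m.
Qed.

(** * Linear functionals *)

Lemma extE (A : monom -> nat -> K) f :
  ext A f = \sum_(i < size f) mmap idfun (A^~ i) (f`_i).
Proof. by rewrite unlock. Qed.

Lemma ext_widen A f N :
  (size f <= N)%N -> ext A f = \sum_(i < N) mmap idfun (A^~ i) (f`_i).
Proof.
move=> le_fN; rewrite extE (big_ord_widen N (fun i => mmap idfun (A^~ i)
  (f`_i))) //.
rewrite [RHS](bigID (fun i : 'I_N => i < size f)%N) /=.
rewrite [X in _ = _ + X]big1 ?addr0 // => i.
by rewrite -leqNgt => le_fi; rewrite nth_default // mmap0.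
Qed.

Lemma ext0 A : ext A (0 : S) = 0.
Proof. by rewrite extE /= size_poly0 big_ord0. Qed.

Lemma extD A f g : ext A (f + g) = ext A f + ext A g.
Proof.
pose N := maxn (size (f + g)) (maxn (size f) (size g)).
rewrite !(@ext_widen A _ N) ?leq_max ?leqnn ?orbT // -big_split /=.
by apply: eq_bigr => i _; rewrite coef_skewD mmapD.
Qed.

Lemma extZ A c f : ext A (kscale c f) = c * ext A f.
Proof.
pose N := maxn (size (kscale c f)) (size f).
rewrite !(@ext_widen A _ N) ?leq_max ?leqnn ?orbT // mulr_sumr.
apply: eq_bigr => i _; rewrite coef_kscale mul_malgC.
rewrite (@mmapEw _ _ _ _ _ (msupp f`_i)) ?msuppZ_le // mulr_sumr.
by apply: eq_bigr => m _; rewrite mcoeffZ mulrA.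
Qed.

Lemma ext_mon A m i : ext A (mon m i) = A m i.
Proof.
rewrite (@ext_widen A _ (maxn (size (mon m i)) i.+1)) ?leq_maxl //.
have lt_i : (i < maxn (size (mon m i)) i.+1)%N by rewrite leq_max leqnn orbT.
rewrite (bigD1 (Ordinal lt_i)) //= big1 ?addr0 => [|k].
  by rewrite coef_mon eqxx mmapU mul1r.
by rewrite -val_eqE /= coef_mon => /negbTE->; rewrite mmap0.
Qed.

Lemma eq_ext A B f :
  (forall m i, mcf f m i != 0 -> A m i = B m i) -> ext A f = ext B f.
Proof.
move=> eqAB; apply: (@skew_span (fun g => ext A g = ext B g)).
- by rewrite !ext0.
- by move=> g h eq_g eq_h; rewrite !extD eq_g eq_h.
- by move=> m i /eqAB eq_mi; rewrite !extZ !ext_mon eq_mi.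
Qed.

Lemma ext_eq0 A f : (forall m i, mcf f m i != 0 -> A m i = 0) -> ext A f = 0.
Proof.
move=> A0; rewrite (@eq_ext _ (fun _ _ => 0) f) // extE.
by rewrite big1 // => i _; rewrite mmapE big1 // => m _; rewrite mulr0.
Qed.

Lemma ext_scale A c f : ext (fun m i => A m i * c) f = ext A f * c.
Proof.
apply: (@skew_span (fun g => ext (fun m i => A m i * c) g = ext A g * c)).
- by rewrite !ext0 mul0r.
- by move=> g h eq_g eq_h; rewrite !extD eq_g eq_h mulrDl.
- by move=> m i _; rewrite !extZ !ext_mon mulrA.
Qed.

(** The functional sending f to A(a s^i f b s^j), by the formula (a s^i)(m s^n)(b s^j) = a sigma^i(m
    sigma^n(b)) s^(i+n+j). *)
Definition twist A a i b j : monom -> nat -> K :=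
  fun m n => A (a * shm i (m * shm n b))%M (i + (n + j))%N.

Lemma sandwichE a i f b j : sandwich a i f b j = mon a i * f * mon b j.
Proof. by rewrite unlock. Qed.

Lemma sandwich0 a i b j : sandwich a i (0 : S) b j = 0.
Proof. by rewrite sandwichE mulr0 mul0r. Qed.

Lemma sandwichD a i f g b j :
  sandwich a i (f + g) b j = sandwich a i f b j + sandwich a i g b j.
Proof. rewrite !sandwichE lskew_mulDr; exact: lskew_mulDl. Qed.

Lemma sandwichZ a i c f b j :
  sandwich a i (kscale c f) b j = kscale c (sandwich a i f b j).
Proof. by rewrite !sandwichE kscaleAr kscaleAl. Qed.

Lemma sandwich_mon a i m n b j :
  sandwich a i (mon m n) b j = mon (a * shm i (m * shm n b))%M (i + (n + j)).
Proof. by rewrite sandwichE -mulrA !mon_mul. Qed.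

Lemma ext_sandwich A f a i b j :
  ext A (sandwich a i f b j) = ext (twist A a i b j) f.
Proof.
apply: (@skew_span (fun g => ext A (sandwich a i g b j) = ext (twist A a i b j)
  g)).
- by rewrite sandwich0 !ext0.
- by move=> g h eq_g eq_h; rewrite sandwichD !extD eq_g eq_h.
- by move=> m n _; rewrite sandwichZ sandwich_mon !extZ !ext_mon.
Qed.

(** * Monomial orderings *)

Section Ordering.
Variable (prec : S -> S -> Prop).
Hypothesis prec_ordering : monomial_ordering prec.

Definition preceq (v w : S) := v = w \/ prec v w.

Lemma preceq_refl v : preceq v v. Proof. by left. Qed.

Lemma MonS_mon m i : MonS (mon m i). Proof. by exists m, i;
  rewrite mon_smon. Qed.
Hint Resolve MonS_mon : core.

Lemma prec_irr v : MonS v -> ~ prec v v.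
Proof. by case: prec_ordering => irr _ _ _ _; apply: irr. Qed.

Lemma prec_trans u v w :
  MonS u -> MonS v -> MonS w -> prec u v -> prec v w -> prec u w.
Proof. by case: prec_ordering => _ tr _ _ _; apply: tr. Qed.

Lemma prec_total v w : MonS v -> MonS w -> [\/ prec v w, v = w | prec w v].
Proof. by case: prec_ordering => _ _ tot _ _; apply: tot. Qed.

Lemma prec_mul v w p q : MonS v -> MonS w -> MonS p -> MonS q ->
  prec v w -> prec (p * v * q) (p * w * q).
Proof. by case: prec_ordering => _ _ _ _ pm; apply: pm. Qed.

Lemma prec_ind (Q : S -> Prop) :
  (forall w, MonS w -> (forall v, MonS v -> prec v w -> Q v) -> Q w) ->
  forall w, MonS w -> Q w.
Proof.
move=> IH w Mw; apply: contrapT => nQw.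
case: prec_ordering => irr tr _ wf _.
have [] := wf [set v | MonS v /\ ~ Q v].
- by move=> v [].
- by exists w.
move=> v [Mv nQv] min_v; apply: nQv; apply: IH => // u Mu lt_uv.
apply: contrapT => nQu; have ne_uv : u <> v by move=> eq_uv;
  apply: (irr v) => //; rewrite -{1}eq_uv.
by apply: (irr u) => //; apply: (tr _ v) => //; apply: min_v.
Qed.

Lemma preceq_trans u v w : MonS u -> MonS v -> MonS w ->
  preceq u v -> preceq v w -> preceq u w.
Proof.
move=> Mu Mv Mw [->//|lt_uv] [<-|lt_vw]; right=> //.
exact: prec_trans lt_vw.
Qed.

Lemma prec_preceq_trans u v w : MonS u -> MonS v -> MonS w ->
  prec u v -> preceq v w -> prec u w.
Proof. by move=> Mu Mv Mw lt_uv [<-//|]; apply: prec_trans. Qed.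

Lemma preceq_mul v w p q : MonS v -> MonS w -> MonS p -> MonS q ->
  preceq v w -> preceq (p * v * q) (p * w * q).
Proof. by move=> Mv Mw Mp Mq [->|lt_vw]; [left|right; apply: prec_mul]. Qed.

Lemma preceq_antisym v w : MonS v -> MonS w -> preceq v w -> ~ prec w v.
Proof.
move=> Mv Mw le_vw lt_wv; apply: (@prec_irr w) => //.
exact: prec_preceq_trans le_vw.
Qed.

Lemma mon_mul_preceq m i m' i' a j a' j' : preceq (mon m i) (mon m' i') ->
  preceq (mon a j) (mon a' j') ->
    preceq (mon (m * shm i a)%M (i + j)) (mon (m' * shm i' a')%M (i' + j')).
Proof.
rewrite -!mon_mul; move=> le_m le_a;
  apply: (@preceq_trans _ (mon m' i' * mon a j)); rewrite ?mon_mul //.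
- have := @preceq_mul (mon m i) (mon m' i') 1 (mon a j).
  by rewrite -mon1 !mon_mul !mul1m !shm0 !add0n; apply.
- have := @preceq_mul (mon a j) (mon a' j') (mon m' i') 1.
  by rewrite -mon1 !mon_mul !shm1 !mulm1 !addn0; apply.
Qed.

Lemma occursE m i f : occurs (mon m i) f <-> mcf f m i != 0.
Proof.
split=> [[a [j []]]|f_mi]; last by exists m, i; rewrite -mcfE mon_smon.
by rewrite -mon_smon -mcfE => /mon_inj[-> ->].
Qed.

Lemma seq_max (s : seq (monom * nat)) : s != [::] ->
  exists2 u, u \in s & forall v, v \in s -> preceq (mon v.1 v.2) (mon u.1 u.2).
Proof.
elim: s => // u [|v s] IHs _.
  by exists u => [|v]; rewrite inE // => /eqP->; left.
have [//|w w_vs max_w] := IHs.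
have [lt_uw|eq_uw|lt_wu] :=
  @prec_total (mon u.1 u.2) (mon w.1 w.2) (MonS_mon _ _) (MonS_mon _ _).
- exists w => [|t]; first by rewrite inE w_vs orbT.
  by rewrite inE => /predU1P[->|/max_w//]; right.
- exists w => [|t]; first by rewrite inE w_vs orbT.
  by rewrite inE => /predU1P[->|/max_w//]; left.
exists u => [|t]; first by rewrite inE eqxx.
rewrite inE => /predU1P[->|/max_w le_tw]; first by left.
by apply: preceq_trans le_tw _ => //; right.
Qed.

Lemma lm_exists f : f <> 0 -> exists m i, is_lm prec f (mon m i).
Proof.
move=> f_neq0.
pose s := [seq (m, i) | i <- iota 0 (size f), m <- msupp f`_i : seq monom].
have s_f m i : mcf f m i != 0 -> (m, i) \in s.
  rewrite mcfE => f_mi; apply/allpairsPdep; exists i, m; split=> //.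
    rewrite mem_iota add0n /= ltnNge; apply: contra f_mi => le_fi.
    by rewrite nth_default ?mcoeff0.
  by rewrite -mcoeff_neq0.
have f_s m i : (m, i) \in s -> mcf f m i != 0.
  by case/allpairsPdep => j [a [_ f_a [-> ->]]]; rewrite mcfE mcoeff_neq0.
have [s0|/seq_max[[m i] /f_s f_mi max_mi]] := eqVneq s [::].
  case: f_neq0; apply: mcfP => m i; rewrite mcf0; apply/eqP/negPn/negP.
  by move/s_f; rewrite s0.
exists m, i; split; first exact/occursE.
move=> _ [a [j [-> f_aj]]]; rewrite -mcfE in f_aj; rewrite -mon_smon => ne.
by have [] := max_mi _ (s_f _ _ f_aj).
Qed.

(** The other monomials of [f] are below the leading one, where [A] vanishes, so a single term
    survives. Hence such a functional, if nonzero at lm(f), does not vanish on [f]. *)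
Lemma ext_lm A f m i : is_lm prec f (mon m i) ->
    (forall a j, A a j != 0 -> preceq (mon m i) (mon a j)) ->
  ext A f = mcf f m i * A m i.
Proof.
move=> [_ max_f] A_ge.
pose B a j := if (a == m) && (j == i) then A m i else 0.
have -> : ext A f = ext B f.
  apply: eq_ext => a j f_aj; rewrite /B;
    case: ifP => [/andP[/eqP-> /eqP->] //|ne].
  apply/eqP/negPn/negP => /A_ge le_mia.
  apply: (preceq_antisym _ _ le_mia) => //; apply: max_f; first exact/occursE.
  by case/mon_inj => eq_a eq_j; rewrite eq_a eq_j !eqxx in ne.
apply: (@skew_span (fun g => ext B g = mcf g m i * A m i)).
- by rewrite ext0 mcf0 mul0r.
- by move=> g h eq_g eq_h; rewrite extD mcfD eq_g eq_h mulrDl.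
- move=> a j _; rewrite extZ ext_mon mcfZ mcf_mon /B -mulrA; congr (_ * _).
  by rewrite [i == j]eq_sym; case: ifP => _; rewrite ?mul1r ?mul0r.
Qed.

End Ordering.
End Letterplace.

(** * Normal forms modulo a subspace *)

Section NormalForms.
Variables (K : fieldType) (X : countType).

Local Notation P := (lpoly K X).
Local Notation monom := {cmonom (X * posn)%type}.
Local Notation S := (lskew K X).
Local Notation mon := (@mon K X).
Implicit Types (f g h r : S) (m a b : monom) (c : K) (i j k n : nat).

Variable (prec : S -> S -> Prop).
Hypothesis prec_ordering : monomial_ordering prec.
Local Notation preceq := (preceq prec).

Variable V : set S.
Hypothesis V0 : V 0.
Hypothesis VD : forall f g, V f -> V g -> V (f + g).
Hypothesis VZ : forall c f, V f -> V (kscale c f).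

Definition normal r := forall m i, mcf r m i != 0 -> ~ lm_set prec V (mon m i).

Let VB f g : V f -> V g -> V (f - g).
Proof. by move=> Vf Vg; apply: VD => //; rewrite -kscaleN1; apply: VZ. Qed.

(** Well-founded induction on a bound [w] of the monomials of [f]: the term at [w] is cancelled by
    an element of V if [w] is in lm(V), and is kept in the normal form otherwise. *)
Lemma normal_form_bounded w : MonS w -> forall f,
    (forall m i, mcf f m i != 0 -> preceq (mon m i) w) ->
  exists r, [/\ V (f - r), normal r &
                forall m i, mcf r m i != 0 -> preceq (mon m i) w].
Proof.
move: w; apply: (prec_ind prec_ordering) => _ [m [i ->]];
  rewrite -mon_smon => IHw f le_fw.
(* Strictly below [w], the induction hypothesis is applied at the leading monomial of [g]. *)
have reduce g : (forall a j, mcf g a j != 0 -> prec (mon a j) (mon m i)) ->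
    exists r, [/\ V (g - r), normal r &
                  forall a j, mcf r a j != 0 -> prec (mon a j) (mon m i)].
  move=> lt_gw; have [->|/eqP g_neq0] := eqVneq g 0.
    exists 0; split=> [|a j|a j]; rewrite ?mcf0 ?eqxx //; exact: VB.
  have [a [j [occ_g max_g]]] := lm_exists prec_ordering g_neq0.
  have lt_ajw : prec (mon a j) (mon m i) by apply/lt_gw/occursE.
  have [||r [Vgr nr le_r]] := IHw (mon a j) _ lt_ajw g; first exact: MonS_mon.
    move=> b k g_bk; have [->|/eqP ne] := pselect (mon b k = mon a j);
      first by left.
    by right; apply: max_g; [exact/occursE|exact/eqP].
  exists r; split=> // b k /le_r [->//|lt_bk].
  by apply: (prec_trans prec_ordering) lt_bk lt_ajw; apply: MonS_mon.
have [[h [Vh h_neq0 [/occursE h_mi max_h]]]|w_normal] :=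
    pselect (lm_set prec V (mon m i)).
  pose h' := kscale (- (mcf f m i / mcf h m i)) h.
  have Vh' : V h' by apply: VZ.
  have [|r [Vr nr lt_r]] := reduce (f + h').
    move=> a j fh_aj.
    have ne : mon a j <> mon m i.
      case/mon_inj => eq_a eq_j; case/eqP: fh_aj.
      by rewrite eq_a eq_j mcfD mcfZ mulNr divfK // subrr.
    have [f_aj|f_aj] := eqVneq (mcf f a j) 0; last by have [] := le_fw _ _ f_aj.
    apply: max_h => //; apply/occursE; apply: contraNneq fh_aj => h_aj.
    by rewrite mcfD f_aj mcfZ h_aj mulr0 addr0.
  exists r; split=> // [|a j /lt_r]; last by right.
  have -> : f - r = (f + h' - r) - h' by apply: mcfP => a j;
    rewrite !(mcfD, mcfN); ring.
  exact: VB.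
pose t := kscale (mcf f m i) (mon m i).
have t_aj a j : mon a j <> mon m i -> mcf t a j = 0.
  move=> ne; rewrite mcfZ mcf_mon; case: eqP => [eq_a|]; last by rewrite mulr0.
  by case: eqP => [eq_j|]; rewrite ?mulr0 //; case: ne; rewrite eq_a eq_j.
have [|r [Vr nr lt_r]] := reduce (f - t).
  move=> a j ft_aj; have ne : mon a j <> mon m i.
    case/mon_inj => eq_a eq_j; case/eqP: ft_aj.
    by rewrite eq_a eq_j -kscaleN1 mcfD mcfZ mcfZ mcf_mon !eqxx mulN1r mulr1
      subrr.
  have [] // := le_fw a j _; apply: contraNneq ft_aj => f_aj.
  by rewrite mcfD mcfN f_aj t_aj // oppr0 addr0.
exists (r + t); split.
- have -> : f - (r + t) = f - t - r by apply: mcfP => a j;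
    rewrite !(mcfD, mcfN); ring.
  exact: Vr.
- move=> a j rt_aj; have [->//|ne] := pselect (mon a j = mon m i).
  by apply: nr; rewrite mcfD t_aj // addr0 in rt_aj.
move=> a j rt_aj; have [->|ne] := pselect (mon a j = mon m i); first by left.
by right; apply: lt_r; rewrite mcfD t_aj // addr0 in rt_aj.
Qed.

(** The leading monomial of [f] is the sharpest bound; quantifying over all bounds [w] also covers f
    = 0, which has no leading monomial. *)
Lemma normal_form f : exists r, [/\ V (f - r), normal r &
  forall w, MonS w -> (forall m i, mcf f m i != 0 -> preceq (mon m i) w) ->
    forall m i, mcf r m i != 0 -> preceq (mon m i) w].
Proof.
have [->|/eqP f_neq0] := eqVneq f 0.
  exists 0; split=> [|m i|w _ _ m i]; rewrite ?mcf0 ?eqxx //; exact: VB.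
have [m [i [/occursE f_mi max_f]]] := lm_exists prec_ordering f_neq0.
have [|a j f_aj|r [Vr nr le_r]] := @normal_form_bounded (mon m i) _ f.
- exact: MonS_mon.
- have [->|ne] := pselect (mon a j = mon m i); first by left.
  by right; apply: max_f => //; apply/occursE.
exists r; split=> // w Mw le_fw a j /le_r le_aj.
by apply: (preceq_trans prec_ordering) le_aj (le_fw _ _ f_mi) => //;
  apply: MonS_mon.
Qed.

Lemma normal_eq0 f : V f -> normal f -> f = 0.
Proof.
move=> Vf nf; apply: contrapT => f_neq0.
have [m [i lm_f]] := lm_exists prec_ordering f_neq0.
by apply: (nf m i); [apply/occursE; case: lm_f|exists f].
Qed.

(* Take the coefficient of [mon m i] in the normal form modulo V. *)
Lemma dual_functional m i : ~ lm_set prec V (mon m i) ->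
  exists A : monom -> nat -> K, [/\ forall f, V f -> ext A f = 0, A m i = 1 &
    forall a j, A a j != 0 -> preceq (mon m i) (mon a j)].
Proof.
move=> nw; have [N NP] := choice normal_form.
(* Normal forms are unique, because the difference of two of them is a normal element of V; it
   follows that [N] is linear. *)
have N_eq f r : V (f - r) -> normal r -> N f = r.
  move=> Vfr nr; have [Vf nf _] := NP f.
  have /(congr1 (fun g => mcf g)) Nr0 : N f - r = 0.
    apply: normal_eq0.
      have -> : N f - r = (f - r) - (f - N f).
        by apply: mcfP => a j; rewrite !(mcfD, mcfN); ring.
      exact: VB.
    move=> a j; rewrite mcfD mcfN => Nr_aj.
    have [r_aj|] := eqVneq (mcf r a j) 0; last exact: nr.
    by apply: nf; rewrite r_aj oppr0 addr0 in Nr_aj.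
  apply: mcfP => a j; have := congr1 (fun F => F a j) Nr0.
  by rewrite mcfD mcfN mcf0 => /eqP; rewrite subr_eq0 => /eqP.
have N0 : N 0 = 0.
  by apply: N_eq => [|a j]; [exact: VB | rewrite mcf0 eqxx].
have ND f g : N (f + g) = N f + N g.
  have [[Vf nf _] [Vg ng _]] := (NP f, NP g).
  apply: N_eq.
    have -> : f + g - (N f + N g) = (f - N f) + (g - N g).
      by apply: mcfP => a j; rewrite !(mcfD, mcfN); ring.
    exact: VD.
  move=> a j; rewrite mcfD => fg_aj.
  have [f_aj|] := eqVneq (mcf (N f) a j) 0; last exact: nf.
  by apply: ng; rewrite f_aj add0r in fg_aj.
have NZ c f : N (kscale c f) = kscale c (N f).
  have [Vf nf _] := NP f; apply: N_eq.
    have -> : kscale c f - kscale c (N f) = kscale c (f - N f).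
      by apply: mcfP => a j; rewrite !(mcfD, mcfN, mcfZ); ring.
    exact: VZ.
  by move=> a j; rewrite mcfZ mulf_eq0 negb_or => /andP[_ /nf].
exists (fun a j => mcf (N (mon a j)) m i).
have extN f : ext (fun a j => mcf (N (mon a j)) m i) f = mcf (N f) m i.
  apply: (@skew_span _ _ (fun g => ext _ g = mcf (N g) m i)).
  - by rewrite ext0 N0 mcf0.
  - by move=> g h eq_g eq_h; rewrite extD ND mcfD eq_g eq_h.
  - by move=> a j _; rewrite extZ ext_mon NZ mcfZ.
split=> [f Vf||a j].
- rewrite extN (N_eq f 0) ?mcf0 // => [|a j]; last by rewrite mcf0 eqxx.
  exact: VB.
- rewrite (N_eq _ (mon m i)) ?mcf_mon ?eqxx // => [|a j].
    have -> : mon m i - mon m i = 0 by apply: mcfP => a j;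
      rewrite mcfD mcfN mcf0 subrr.
    exact: V0.
  by move=> /mcf_mon_neq0[<- <-].
(* The normal form of [mon a j] only involves monomials up to [mon a j], so [mon m i] can occur in
   it only if it is one of these. *)
have [_ _ le_N] := NP (mon a j); move: (m) (i); apply: le_N => [|b k].
  exact: MonS_mon.
by move=> /mcf_mon_neq0[<- <-]; left.
Qed.

(** Modulo V, [f] equals a nonzero normal element; the functional dual to the leading monomial of
    that element is nonzero on it by [ext_lm]. *)
Lemma separating_functional f : ~ V f ->
  exists A : monom -> nat -> K, (forall g, V g -> ext A g = 0) /\ ext A f != 0.
Proof.
move=> nVf; have [r [Vfr nr _]] := normal_form f.
have [r0|/eqP r_neq0] := eqVneq r 0.
  case: nVf; have -> : f = f - r; last by [].
  by apply: mcfP => m i; rewrite r0 mcfD mcfN mcf0 subr0.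
have [m [i lm_r]] := lm_exists prec_ordering r_neq0.
have r_mi : mcf r m i != 0 by apply/occursE; case: lm_r.
have [A [A0 A1 A_ge]] := dual_functional (nr _ _ r_mi).
exists A; split=> //; have -> : f = (f - r) + r.
  by apply: mcfP => a j; rewrite !(mcfD, mcfN); ring.
by rewrite extD A0 // add0r (ext_lm prec_ordering lm_r A_ge) A1 mulr1.
Qed.

End NormalForms.

(** * The extension of an ideal of R to S *)

Section Extension.
Variables (K : fieldType) (X : countType).

Local Notation P := (lpoly K X).
Local Notation monom := {cmonom (X * posn)%type}.
Local Notation S := (lskew K X).
Local Notation mon := (@mon K X).
Local Notation R := (@Rsub K X).
Local Notation wmon u := (mon (wd u) (size u)).
Implicit Types (f g h : S) (m a b : monom) (c : K) (i j k n e : nat) (u v :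
  seq X).
Implicit Types A B C : monom -> nat -> K.

(** * The subalgebra R as the span of the words *)

Lemma supp_mul (Z1 Z2 Z3 : monom -> nat -> Prop) f g :
    (forall m i a j, Z1 m i -> Z2 a j -> Z3 (m * shm i a)%M (i + j)) ->
    (forall m i, mcf f m i != 0 -> Z1 m i) ->
    (forall m i, mcf g m i != 0 -> Z2 m i) ->
  forall m i, mcf (f * g) m i != 0 -> Z3 m i.
Proof.
move=> Z12 Zf Zg.
pose Q h := forall m i, mcf h m i != 0 -> Z3 m i.
have Q0 : Q 0 by move=> m i; rewrite mcf0 eqxx.
have QD h1 h2 : Q h1 -> Q h2 -> Q (h1 + h2).
  move=> Qh1 Qh2 m i; rewrite mcfD => h12.
  have [h1_mi|] := eqVneq (mcf h1 m i) 0; last exact: Qh1.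
  by apply: Qh2; rewrite h1_mi add0r in h12.
suff: Q (f * g) by [].
apply: (@skew_span _ _ (fun h => Q (h * g))).
- by rewrite mul0r.
- by move=> h1 h2 Qh1 Qh2; rewrite lskew_mulDl; apply: QD.
move=> m i /Zf Z1m; rewrite kscaleAl.
have QZ c h : Q h -> Q (kscale c h).
  by move=> Qh a j; rewrite mcfZ mulf_eq0 negb_or => /andP[_ /Qh].
apply: (QZ); apply: (@skew_span _ _ (fun h => Q (mon m i * h))).
- by rewrite mulr0.
- by move=> h1 h2 Qh1 Qh2; rewrite lskew_mulDr; apply: QD.
move=> a j /Zg Z2a; rewrite kscaleAr mon_mul; apply: (QZ) => b n.
by move=> /mcf_mon_neq0[<- <-]; apply: Z12.
Qed.

Lemma Rsub_subalgebra : subalgebra R.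
Proof.
split.
- by move=> A [[]].
- by move=> f g Rf Rg A RA; case: (RA) => -[_ AD _ _] _; apply: AD;
    [apply: Rf|apply: Rg].
- by move=> f g Rf Rg A RA; case: (RA) => -[_ _ AM _] _; apply: AM;
    [apply: Rf|apply: Rg].
- by move=> c f Rf A RA; case: (RA) => -[_ _ _ AZ] _; apply: AZ; apply: Rf.
Qed.

Lemma kscale_scale c f : (c%:MP : P) *: f = kscale c f.
Proof. by rewrite unlock. Qed.

(** The elements supported on words whose length is the exponent of s form a subalgebra containing
    the generators, as words multiply by concatenation. *)
Lemma Rsub_supp f m i :
  R f -> mcf f m i != 0 -> exists2 u, size u = i & m = wd u.
Proof.
pose Z (m : monom) (i : nat) := exists2 u, size u = i & m = wd u.
move=> Rf; move: m i; pose Q f := forall m i, mcf f m i != 0 -> Z m i.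
suff: Q f by [].
apply: Rf; split; first split.
- rewrite -(@mon1 K X) => m i /mcf_mon_neq0[<- <-]; by exists [::].
- move=> g h Qg Qh m i; rewrite mcfD => gh_mi.
  have [g_mi|] := eqVneq (mcf g m i) 0; last exact: Qg.
  by apply: Qh; rewrite g_mi add0r in gh_mi.
- move=> g h Qg Qh; apply: supp_mul Qg Qh => _ _ _ _ [u <- ->] [v <- ->].
  by exists (u ++ v); rewrite ?size_cat ?wd_cat.
- by move=> c g Qg m i;
    rewrite kscale_scale mcfZ mulf_eq0 negb_or => /andP[_ /Qg].
move=> _ [x ->] m i; have -> : lvar K x pos1 *: skewX (@shift K X) = wmon [::
  x].
  by rewrite mon_smon /wd /= shm1 mulm1.
by move=> /mcf_mon_neq0[<- <-]; exists [:: x].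
Qed.

Lemma Rsub_word u : R (wmon u).
Proof.
have [R1 _ RM _] := Rsub_subalgebra.
elim: u => [|x u IHu]; first by rewrite mon1.
have -> : wmon (x :: u) = wmon [:: x] * wmon u.
  by rewrite mon_mul -(wd_cat [:: x] u).
apply: RM => //; rewrite mon_smon /wd /= shm1 mulm1.
by apply: sub_gen_smallest; exists x.
Qed.

Lemma Rsub_kscale c f : R f -> R (kscale c f).
Proof.
by move=> Rf; rewrite -kscale_scale; have [_ _ _ RZ] := Rsub_subalgebra;
  apply: RZ.
Qed.

Lemma Rsub_from_supp f :
  (forall m i, mcf f m i != 0 -> exists2 u, size u = i & m = wd u) -> R f.
Proof.
have [R1 RD _ _] := Rsub_subalgebra => supp_f; apply: (@skew_span _ _ R).
- by rewrite -(kscale0 1); apply: Rsub_kscale.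
- exact: RD.
- move=> m i /supp_f[u <- ->]; apply: Rsub_kscale; exact: Rsub_word.
Qed.

Variable I : set S.
Hypothesis I_ideal : two_sided_ideal R I.
Hypothesis I_graded : graded I.
Variable (prec : S -> S -> Prop).
Hypothesis prec_ordering : monomial_ordering prec.
Local Notation preceq := (preceq prec).
Local Notation J := (ideal_gen setT I).

Lemma ideal0 : I 0. Proof. by case: I_ideal. Qed.
Lemma idealD f g : I f -> I g -> I (f + g).
Proof. by case: I_ideal => _ _ ID _; apply: ID. Qed.

Lemma idealZ c f : I f -> I (kscale c f).
Proof.
have [_ _ _ IM] := I_ideal; have [R1 _ _ _] := Rsub_subalgebra => If.
have -> : kscale c f = kscale c 1 * f by rewrite kscaleAl mul1r.
exact: (IM _ _ (Rsub_kscale c R1) If).1.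
Qed.

Lemma ideal_sandwich u v f :
  I f -> I (sandwich (wd u) (size u) f (wd v) (size v)).
Proof.
have [_ _ _ IM] := I_ideal => If; rewrite sandwichE.
exact: (IM _ _ (Rsub_word v) (IM _ _ (Rsub_word u) If).1).2.
Qed.

Lemma ideal_supp f m i :
  I f -> mcf f m i != 0 -> exists2 u, size u = i & m = wd u.
Proof. by case: I_ideal => IR _ _ _ /IR; apply: Rsub_supp. Qed.

(** * Functionals vanishing on the extension of I *)

Definition concentrated e f := forall m i, mcf f m i != 0 -> i = e.

Lemma concentrated_supp e f : I f -> concentrated e f ->
  forall m i, mcf f m i != 0 -> i = e /\ exists2 u, size u = e & m = wd u.
Proof.
move=> If fe m i f_mi; have [u] := ideal_supp If f_mi.
by rewrite (fe _ _ f_mi); split=> //; exists u.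
Qed.

(** The grading of I is used here: every component of [f] lies in I, and [ext A] is additive. *)
Lemma ext_ideal_eq0 A :
    (forall e f, I f -> concentrated e f -> ext A f = 0) ->
  forall f, I f -> ext A f = 0.
Proof.
move=> A0 f If; rewrite [f]skew_expand.
apply: (big_ind (fun g : S => ext A g = 0)) => [|g h g0 h0|[e /= _] _].
- exact: ext0.
- by rewrite extD g0 h0 addr0.
apply: (A0 e); first exact: I_graded.
move=> m i; rewrite mcfE coef_skewZ coef_skewXn.
by case: (i =P e) => // _; rewrite mulr0n mulr0 mcoeff0 eqxx.
Qed.

(* Since I is graded, [kills A] says that A vanishes on all the products
   a s^i f b s^j with f in I, which span J over K. *)
Definition kills A := forall e f, I f -> concentrated e f ->
  forall a i b j, ext (twist A a i b j) f = 0.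

(** The elements on which [A] vanishes after any multiplication by monomials on both sides form a
    two-sided ideal of S; it contains I, hence J. *)
Lemma kills_extension A f : kills A -> J f -> ext A f = 0.
Proof.
move=> kA Jf.
pose Q : set S := [set g | forall a i b j, ext A (sandwich a i g b j) = 0].
suff /(_ f Jf 1%M 0 1%M 0) : J `<=` Q by rewrite sandwichE mon1 mul1r mulr1.
apply: smallest_sub => [|g Ig a i b j]; last first.
  rewrite ext_sandwich; apply: ext_ideal_eq0 Ig => e h Ih he;
    exact: kA he _ _ _ _.
split=> //.
- by move=> a i b j; rewrite sandwich0 ext0.
- by move=> g h Qg Qh a i b j; rewrite sandwichD extD Qg Qh addr0.
move=> h g _ Qg; split=> a i b j.
- apply: (@skew_span _ _ (fun h => ext A (sandwich a i (h * g) b j) = 0)).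
  + by rewrite mul0r sandwich0 ext0.
  + move=> h1 h2 Qh1 Qh2;
      rewrite lskew_mulDl sandwichD extD [X in X + _]Qh1 add0r.
    exact: Qh2.
  move=> m n _; rewrite kscaleAl sandwichZ extZ.
  have -> : sandwich a i (mon m n * g) b j = sandwich (a * shm i m)%M (i + n) g
    b j.
    by rewrite !sandwichE -mon_mul lskew_mulA.
  by rewrite Qg mulr0.
- apply: (@skew_span _ _ (fun h => ext A (sandwich a i (g * h) b j) = 0)).
  + by rewrite mulr0 sandwich0 ext0.
  + move=> h1 h2 Qh1 Qh2;
      rewrite lskew_mulDr sandwichD extD [X in X + _]Qh1 add0r.
    exact: Qh2.
  move=> m n _; rewrite kscaleAr sandwichZ extZ.
  have -> : sandwich a i (g * mon m n) b j = sandwich a i g (m * shm n b)%M (n +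
    j).
    rewrite !sandwichE.
    rewrite -mon_mul.
    apply: etrans (esym (lskew_mulA (mon a i * g) _ _)).
    exact: (congr1 (fun x : S => x * mon b j) (lskew_mulA _ g _)).
  by rewrite Qg mulr0.
Qed.

(** The functional [A] preceded by the projection of S onto R that drops all monomials other than
    words. *)
Definition Rproj A m n :=
  if `[< exists2 u, size u = n & m = wd u >] then A m n else 0.

Lemma Rproj_word A u : Rproj A (wd u) (size u) = A (wd u) (size u).
Proof. by rewrite /Rproj; case: asboolP => // -[]; exists u. Qed.

Lemma Rproj_neq0 A m n :
  Rproj A m n != 0 -> A m n != 0 /\ exists2 u, size u = n & m = wd u.
Proof. by rewrite /Rproj; case: asboolP => //; rewrite eqxx. Qed.

(* If some product a s^i u b s^j with u a word of length e lies in R, then all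
  of
   them do, and a s^i, b s^j can be replaced by the words around u. *)
Lemma kills_Rproj A : (forall f, I f -> ext A f = 0) -> kills (Rproj A).
Proof.
move=> A0 e f If fe a i b j.
have [[u size_u [v size_v def_v]]|no_word] := pselect (exists2 u, size u = e &
    exists2 v, size v = (i + (e + j))%N & (a * shm i (wd u * shm e b))%M = wd
      v).
  (* As P is commutative, what surrounds [u] in the product is [a] times the shift of [b] by i + e;
     it splits into a word before [u] and a word after it. *)
  have [||v1 [v2 [def_v12 size_v1 def_ab]]] :=
      @wd_factor X (a * shm (i + e) b)%M i u v.
  - by rewrite -def_v shmM shmD -mulmA [X in (a * X)%M]mulmC.
  - by rewrite size_v size_u leq_add2l leq_addr.
  have size_v2 : size v2 = j.
    by have := congr1 size def_v12; rewrite !size_cat size_v size_v1 size_u;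
      lia.
  rewrite -(A0 _ (ideal_sandwich v1 v2 If)) ext_sandwich;
    apply: eq_ext => m n f_mn.
  have [w size_w def_m] := ideal_supp If f_mn; have n_e := fe _ _ f_mn.
  rewrite /twist size_v1 size_v2.
  have -> : (a * shm i (m * shm n b) = wd (v1 ++ w ++ v2))%M.
    rewrite !wd_cat size_v1 size_w shmM shmD shmM shmD -def_m n_e.
    by rewrite mulmA [X in (X * _)%M]mulmC -mulmA def_ab size_u mulmA [X in (X *
      _)%M]mulmC -mulmA.
  have <- : (wd (v1 ++ w ++ v2) = wd v1 * shm i (m * shm n (wd v2)))%M.
    by rewrite !wd_cat size_v1 size_w -def_m.
  have -> : (i + (n + j))%N = size (v1 ++ w ++ v2) by rewrite !size_cat size_v1
    size_v2 size_w.
  exact: Rproj_word.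
(* All monomials of [f] are words of length [e], so in this case no term of the product lies in
   R. *)
apply: ext_eq0 => m n f_mn;
  apply/eqP/negPn/negP => /Rproj_neq0[_ [v size_v def_v]].
have [u size_u def_m] := ideal_supp If f_mn; have n_e := fe _ _ f_mn.
case: no_word; exists u; first by rewrite size_u.
by exists v; rewrite -?def_m -n_e.
Qed.

(** An element of R outside I is separated from I by a functional [A]; then [Rproj A] vanishes on J
    and agrees with [A] on R, so the element is not in J. *)
Lemma extension_contraction f : J f -> R f -> I f.
Proof.
move=> Jf Rf; apply: contrapT => nIf.
have [A [A0 /eqP[]]] :=
  @separating_functional K X prec prec_ordering I ideal0 idealD idealZ f nIf.
rewrite -(kills_extension (kills_Rproj A0) Jf); apply: eq_ext => m i f_mi.
by have [u <- ->] := Rsub_supp Rf f_mi; rewrite Rproj_word.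
Qed.

(** * Functionals attached to divisors of words *)

Definition normal_word u := ~ lm_set prec I (wmon u).

(** The functional dual to [u] modulo I is only known to vanish on I; [Rproj] turns it into one that
    kills J and keeps its value at [u] and its lower bound. *)
Lemma word_functional u : normal_word u ->
  exists A, [/\ kills A, A (wd u) (size u) = 1 & forall m n, A m n != 0 ->
    preceq (wmon u) (mon m n) ].
Proof.
move=> nu; have [A [A0 A1 A_ge]] :=
  dual_functional prec_ordering ideal0 idealD idealZ nu.
exists (Rproj A); split; first exact: kills_Rproj.
  by rewrite Rproj_word.
by move=> m n /Rproj_neq0[/A_ge].
Qed.

(** An element of I of degree 0 in s is a constant, and a nonzero constant would put the empty word
    in lm(I). *)
Lemma concentrated0 f : normal_word [::] -> I f -> concentrated 0 f -> f = 0.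
Proof.
move=> n0 If f0; apply: (normal_eq0 prec_ordering If) => m i f_mi lm_mi;
  apply: n0.
have [u size_u def_m] := ideal_supp If f_mi; have i0 := f0 _ _ f_mi.
by rewrite i0 in size_u; rewrite def_m i0 -size_u (size0nil size_u) in lm_mi.
Qed.

(** For n >= e, m s^n is the product of [lom e m] s^e and [him e m] s^(n-e); the values of [A] and
    [C] at the two factors are multiplied. *)
Definition glue e A C m n :=
  if (n < e)%N then 0 else A (lom e m) e * C (him e m) (n - e)%N.

(* In a s^i f b s^j the letters of f occupy consecutive positions: all among the
   first e, or all beyond them, or else covering [place e], where C vanishes. *)
Lemma kills_glue e A C :
    kills A -> kills C ->
    (forall m k x, (0 < k)%N -> m (x, place 0) != 0%N -> C m k = 0) ->
  kills (glue e A C).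
Proof.
move=> kA kC C0 e' f If fe a i b j.
have supp := concentrated_supp If fe.
have [lt_e|le_e] := ltnP (i + (e' + j)) e.
  by apply: ext_eq0 => m n /supp[-> _]; rewrite /twist /glue lt_e.
have [le_ie'|lt_ie'] := leqP (i + e') e.
  (* Here [f] lies within the first [e] places. As [b] starts behind i + e' places, it is cut at e -
     i - e', and [C] takes the same value [c] on all terms. *)
  pose c := C (him e a * him (e - i - e') b)%M (i + (e' + j) - e)%N.
  pose B := twist A (lom e a) i (lom (e - i - e') b) (e - i - e').
  rewrite (@eq_ext _ _ _ (fun m n => B m n * c)).
    by rewrite ext_scale (kA e') ?mul0r.
  move=> m n /supp[-> [u size_u ->]];
    rewrite /twist /glue ltnNge le_e /= /B /c /twist.
  have -> : (i + (e' + (e - i - e')))%N = e by lia.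
  congr (A _ _ * C _ _).
    apply: monomP => x k; rewrite !monE; case: (ltnP k e) => [lt_ke|le_ke].
      congr (_ + _)%N; case: ifP => // le_ik; congr (_ + _)%N.
      case: ifP => // le_e'; by have -> : (k - i - e' < e - i - e')%N by lia.
    have -> : (i <= k)%N by lia.
    rewrite wdE onth_default; last by lia.
    have -> : (e' <= k - i)%N by lia.
    by have -> : (k - i - e' < e - i - e')%N = false by lia.
  apply: monomP => x k; rewrite !monE; have -> : (i <= k + e)%N by lia.
  rewrite wdE onth_default; last by lia.
  have -> : (e' <= k + e - i)%N by lia.
  by rewrite add0n; congr (_ + b (_, place _))%N; lia.
have [le_ei|lt_ie] := leqP e i.
  (* Here [f] lies beyond the first [e] places, and it is [A] that takes a constant value. *)
  pose c := A (lom e a) e.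
  rewrite (@eq_ext _ _ _ (fun m n => twist C (him e a) (i - e) b j m n * c)).
    by rewrite ext_scale (kC e') ?mul0r.
  move=> m n /supp[-> [u size_u ->]];
    rewrite /twist /glue ltnNge le_e /= mulrC /c.
  have -> : (i + (e' + j) - e = i - e + (e' + j))%N by lia.
  congr (C _ _ * A _ _).
  - apply: monomP => x k; rewrite !monE; congr (_ + _)%N.
    have -> : (i <= k + e)%N = (i - e <= k)%N by lia.
    case: ifP => // le_k; have -> : (k + e - i = k - (i - e))%N by lia.
    by [].
  apply: monomP => x k; rewrite !monE; case: ifP => // lt_ke.
  have -> : (i <= k)%N = false by lia.
  by rewrite addn0.
(* Here [f] straddles the cut: its letter of index e - i lands at the first place of the part given
   to [C]. *)
apply: ext_eq0 => m n /supp[-> [u size_u ->]];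
  rewrite /twist /glue ltnNge le_e /=.
have [x u_x] : exists x, onth u (e - i) = Some x.
  have : isSome (onth u (e - i)) by rewrite onthTE size_u; lia.
  by case: (onth u _) => // x; exists x.
rewrite (C0 _ _ x) ?mulr0 //; first by lia.
by rewrite !monE add0n (ltnW lt_ie) wdE u_x eqxx; lia.
Qed.

Definition delta m2 :
  monom -> nat -> K := fun m k => ((m == m2) && (k == 0%N))%:R.

(** If [f] has positive degree, so has the product, while [delta] is concentrated in degree 0; in
    degree 0, [f] itself is zero. *)
Lemma kills_delta m2 : normal_word [::] -> kills (delta m2).
Proof.
move=> n0 [|e] f If fe a i b j.
  by rewrite (concentrated0 n0 If fe) ext0.
apply: ext_eq0 => m n f_mn; rewrite /twist /delta (fe _ _ f_mn).
by rewrite addnS andbF.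
Qed.

(* [hole B] requires an empty first position and applies B to the rest. *)
Definition hole B m k :=
  if `[< forall x, m (x, place 0) = 0%N >] && (0 < k)%N
  then B (him 1 m) k.-1 else 0.

(** If [i] is 0, a letter of [f] fills the first place. Otherwise that place is empty exactly when
    [a] leaves it empty, and then the whole product can be moved back by one place. *)
Lemma kills_hole B : normal_word [::] -> kills B -> kills (hole B).
Proof.
move=> n0 kB e f If fe a i b j.
have supp := concentrated_supp If fe.
case: e => [|e] in fe supp *; first by rewrite (concentrated0 n0 If fe) ext0.
case: i => [|i].
  apply: ext_eq0 => m n /supp[-> [[|y u] // size_u ->]]; rewrite /twist /hole.
  case: asboolP => //= /(_ y); rewrite !monE wdE subn0 /= eqxx; lia.
have [a0|a_neq0] := pselect (forall x, a (x, place 0) = 0%N).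
  rewrite (@eq_ext _ _ _ (twist B (him 1 a) i b j)); first exact: (kB e.+1).
  move=> m n _; rewrite /twist /hole; case: asboolP => [_|[]] /=; last first.
    by move=> x; rewrite !monE a0.
  congr B; apply: monomP => x k; by rewrite !monE addn1 ltnS !subSS.
apply: ext_eq0 => m n _; rewrite /twist /hole; case: asboolP => //= a0;
  case: a_neq0 => x.
by have := a0 x; rewrite !monE addn0.
Qed.

Lemma lom_shm e m a : (forall x k, (e <= k)%N -> m (x, place k) = 0%N) ->
  lom e (m * shm e a)%M = m.
Proof.
move=> m0; apply: monomP => x k; rewrite !monE.
by case: ltnP => [_|/m0->]; rewrite ?addn0.
Qed.

Lemma him_shm e m a : (forall x k, (e <= k)%N -> m (x, place k) = 0%N) ->
  him e (m * shm e a)%M = a.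
Proof.
by move=> m0; apply: monomP => x k; rewrite !monE m0 leq_addl // add0n addnK.
Qed.

Lemma split_first_run (o : seq (option X)) : exists r,
  o = map Some r \/ exists2 o', o = map Some r ++ None ::
    o' & (size o' < size o)%N.
Proof.
elim: o => [|[x|] o [r IHo]]; first by exists [::]; left.
- exists (x :: r); case: IHo => [->|[o' def_o lt_o']]; [by left | right].
  by exists o'; [rewrite {1}def_o | exact: leqW].
- by exists [::]; right; exists o.
Qed.

(** The shape that [masked_omon] gives to a divisor of a word. *)
Definition template (o : seq (option X)) m2 := (omon o * shm (size o) m2)%M.

(** Induction on the size of [o]: the functional of the first run is glued to [delta m2] if the run
    is all of [o], and otherwise to a [hole] in front of the functional of what follows. *)
Lemma template_functional (o : seq (option X)) m2 :
    (forall o1 r o2, o = o1 ++ map Some r ++ o2 -> normal_word r) ->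
  exists A, [/\ kills A, A (template o m2) (size o) != 0 &
    forall m n, A m n != 0 -> preceq (mon (template o m2) (size o)) (mon m n)].
Proof.
have [n] := ubnP (size o); elim: n o => // n IHn o le_on runs.
(* The empty word counts as a run: the monomial 1 is not in lm(I), so I contains no nonzero
   constant. *)
have n0 : normal_word [::] by apply: (runs [::] [::] o).
have [r def_o] := split_first_run o.
have nr : normal_word r.
  case: def_o => [def_o|[o' def_o _]]; last exact: (runs [::] r (None :: o')).
  by apply: (runs [::] r [::]); rewrite cats0.
have [A [kA A1 A_ge]] := word_functional nr; set e := size r in A1 A_ge *.
have wr0 x k : (e <= k)%N -> wd r (x, place k) = 0%N.
  by move=> le_ek; rewrite wdE onth_default.
have glue_neq0 C m k : glue e A C m k != 0 ->
    [/\ (e <= k)%N, preceq (mon (wd r) e) (mon (lom e m) e) &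
        C (him e m) (k - e)%N != 0].
  rewrite /glue ltnNge; case: (leqP e k) => //= [le_ek|]; last by rewrite eqxx.
  by rewrite mulf_eq0 negb_or => /andP[/A_ge].
case: def_o => [def_o|[o' def_o lt_o']].
  have size_o : size o = e by rewrite def_o size_map.
  have -> : template o m2 = (wd r * shm e m2)%M by rewrite /template size_o
    def_o.
  exists (glue e A (delta m2)); rewrite size_o; split=> [||m k].
  - apply: kills_glue => //; first exact: kills_delta.
    by move=> m k x k_gt0 _; rewrite /delta eqn0Ngt k_gt0 andbF.
  - by rewrite /glue ltnn subnn lom_shm // him_shm // A1 /delta !eqxx mulr1
      oner_neq0.
  case/glue_neq0 => le_ek le_A; rewrite /delta.
  case: (him e m =P m2) => [def_m2|]; last by rewrite eqxx.
  case: ((k - e)%N =P 0%N) => [k_e _|]; last by rewrite eqxx.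
  (* The lower bound for the run is multiplied on the right by [m2], which is the part of [m] beyond
     the run. *)
  have := mon_mul_preceq prec_ordering le_A (preceq_refl prec (mon m2 0)).
  rewrite addn0 -{2}def_m2 -lo_hi.
  by have -> : k = e by lia.
have [||B [kB B_neq0 B_ge]] := IHn o'; first by move: le_on lt_o'; lia.
  move=> o1 s o2 def_o'; apply: (runs (map Some r ++ None :: o1) s o2).
  by rewrite def_o def_o' -catA.
have size_o : size o = (e + (size o').+1)%N.
  by rewrite def_o size_cat size_map.
have -> : template o m2 = (wd r * shm e (shm 1 (template o' m2)))%M.
  rewrite /template {1}def_o omon_cat size_map /= size_o.
  by rewrite !shmM !shmD mulmA addn1 addSnnS.
exists (glue e A (hole B)); rewrite size_o; split=> [||m k].
- apply: kills_glue => //; first exact: kills_hole.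
  move=> m k x k_gt0 m_x; rewrite /hole; case: asboolP => // /(_ x) m0.
  by rewrite m0 in m_x.
- rewrite /glue ltnNge leq_addr /= lom_shm // him_shm // A1 mul1r addKn /hole.
  case: asboolP => [_|[]] /=; last by move=> x; rewrite !monE.
  have -> // : him 1 (shm 1 (template o' m2)) = template o' m2.
  by apply: monomP => x l; rewrite !monE leq_addl addnK.
case/glue_neq0 => le_ek le_A; rewrite /hole.
case: asboolP => [m0|]; last by rewrite eqxx.
case: ifP => [gt_ek /B_ge le_B|]; last by rewrite eqxx.
(* The lower bounds for the run and for the rest are multiplied, with the factor s between them
   standing for the hole. *)
have := mon_mul_preceq prec_ordering le_A
  (mon_mul_preceq prec_ordering (preceq_refl prec (mon 1%M 1)) le_B).
rewrite !mul1m.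
have -> : shm 1 (him 1 (him e m)) = him e m.
  apply: monomP => x l; rewrite !monE; case: l => [|l] /=;
    last by rewrite subn1 addn1.
  by have := m0 x; rewrite !monE.
rewrite -lo_hi; have -> : (e + (1 + (k - e).-1))%N = k by lia.
by rewrite add1n.
Qed.

(** * Leading monomials of I *)

Lemma lm_ideal_word w : lm_set prec I w -> exists u, w = wmon u.
Proof.
case=> f [If _ [[m [i [-> f_mi]]] _]]; rewrite -mcfE in f_mi.
by have [u <- ->] := ideal_supp If f_mi; exists u; rewrite mon_smon.
Qed.

(** The elements all of whose monomials are multiples of monomials of [L] already form a two-sided
    ideal. *)
Lemma monomial_ideal_factor (L : set S) m i :
    L `<=` @MonS K X -> ideal_gen setT L (mon m i) ->
  exists a p l d b q, [/\ L (mon l d), m = (a * shm p (l * shm d b))%M &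
    i = (p + (d + q))%N].
Proof.
move=> L_mon; pose Z m i := exists a p l d b q,
  [/\ L (mon l d), m = (a * shm p (l * shm d b))%M & i = (p + (d + q))%N].
pose Q : set S := [set f | forall m i, mcf f m i != 0 -> Z m i].
suff L_Q : ideal_gen setT L `<=` Q.
  by move=> /L_Q; apply; rewrite mcf_mon !eqxx oner_eq0.
apply: smallest_sub => [|w Lw a n]; last first.
  have [l [d def_w]] := L_mon _ Lw; rewrite def_w -mon_smon in Lw *.
  move=> /mcf_mon_neq0[<- <-].
  by exists 1%M, 0, l, d, 1%M, 0; rewrite shm0 shm1 mulm1 mul1m addn0.
split=> //.
- by move=> a n; rewrite mcf0 eqxx.
- move=> f g Qf Qg a n; rewrite mcfD => fg_an.
  have [f_an|] := eqVneq (mcf f a n) 0; last exact: Qf.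
  by apply: Qg; rewrite f_an add0r in fg_an.
move=> h f _ Qf; split.
- apply: (@supp_mul (fun _ _ => True) Z) => // c k _ _ _ [a [p [l [d [b [q [Ll
    -> ->]]]]]]].
  exists (c * shm k a)%M, (k + p)%N, l, d, b, q; split=> //; last by lia.
  by rewrite shmM shmD mulmA.
apply: (@supp_mul Z (fun _ _ => True)) => // _ _ c k [a [p [l [d [b [q [Ll ->
  ->]]]]]]] _.
exists a, p, l, d, (b * shm q c)%M, (q + k)%N; split=> //; last by lia.
by rewrite !shmM !shmD -!mulmA !addnA.
Qed.

Variable G : set S.
Hypothesis G_multi : multi_homogeneous G.
Hypothesis G_groebner : groebner_basis prec setT J G.

(** All monomials of [g] share one exponent of s and one multidegree, so by [multideg_wd] a single
    word among them forces the others to be words. *)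
Lemma multi_homogeneous_Rsub g u :
  G g -> mcf g (wd u) (size u) != 0 -> R g.
Proof.
move=> Gg; have [mu [i [p p_mu def_g]]] := G_multi Gg.
have g_supp m n : mcf g m n != 0 -> n = i /\ multideg m =1 mu.
  rewrite mcfE def_g coef_skewZ coef_skewXn.
  case: (n =P i) => [->|_]; last by rewrite mulr0n mulr0 mcoeff0 eqxx.
  by rewrite mulr1n mulr1 mcoeff_neq0 => /p_mu.
move=> /g_supp[size_u mu_u]; apply: Rsub_from_supp => m n /g_supp[-> mu_m].
have [|v size_v ->] := @multideg_wd X m u; first by move=> k; rewrite mu_m mu_u.
by exists v; rewrite ?size_v.
Qed.

(** Strong induction on the length of a word [v] in lm(I), which is a multiple of some lm(g): either
    [g] lies in R, or a strictly shorter factor of [v] lies in lm(I). The ideal [A] is arbitrary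
    because [ideal_gen] is an intersection of ideals. *)
Lemma lm_ideal_sub (A : set S) :
    two_sided_ideal R A -> lm_set prec (G `&` R) `<=` A ->
  lm_set prec I `<=` A.
Proof.
case=> _ _ _ AM lmA.
have A_factor v1 u v2 : A (wmon u) -> A (wmon (v1 ++ u ++ v2)).
  move=> Au; have [Au' _] := AM _ _ (Rsub_word v1) Au.
  have [_] := AM _ _ (Rsub_word v2) Au'.
  by rewrite !mon_mul -mulmA !wd_cat !size_cat addnA shmM shmD.
move=> w /[dup] /lm_ideal_word[v ->]; have [n] := ubnP (size v).
elim: n v => // n IHn v le_vn [f [If f_neq0 lm_f]].
have [GJ genG] := G_groebner.
have : ideal_gen setT (lm_set prec G) (wmon v).
  rewrite genG; apply: sub_gen_smallest; exists f; split=> //.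
  exact: sub_gen_smallest.
case/monomial_ideal_factor => [|a [p [l [d [b [q [[g [Gg g_neq0 lm_g]] def_v
  size_v]]]]]]].
  by move=> _ [g [_ _ [[m [i [-> _]]] _]]]; exists m, i.
have g_l : mcf g l d != 0 by apply/occursE; case: lm_g.
have [[u size_u def_l]|l_nword] := pselect (exists2 u, size u = d & l = wd u).
  have [||v1 [v2 [-> _ _]]] := @wd_factor X (a * shm (p + d) b)%M p u v.
  - by rewrite def_v def_l shmM shmD -mulmA [X in (a * X)%M]mulmC.
  - by rewrite size_v size_u; lia.
  apply: A_factor; apply: lmA; exists g; rewrite -def_l size_u; split=> //;
    split=> //.
  by apply: (@multi_homogeneous_Rsub _ u) => //; rewrite -def_l size_u.
(* From place [p] on, [v] is made of [l], of the letters of [a] beyond [p] and of those of [b]; so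
   [l] divides the word [drop p v]. *)
have [|o size_o def_l] := @masked_omon X l (him p a * shm d b)%M d (drop p v).
  rewrite him_wd def_v; apply: monomP => x k; rewrite !monE leq_addl addnK.
  by rewrite addnCA addnA.
have [normal_runs|] := pselect (forall o1 r o2, o = o1 ++ map Some r ++ o2 ->
  normal_word r).
  (* If no run were in lm(I), [B] would vanish on [g], which lies in J, although [ext_lm] gives a
     nonzero value. *)
  have [B [kB B_neq0 B_ge]] := template_functional (him d l) normal_runs.
  rewrite /template size_o -def_l in B_neq0 B_ge.
  have : ext B g = 0 by apply: kills_extension => //; apply: GJ.
  move=> /eqP; rewrite (ext_lm prec_ordering lm_g B_ge) mulf_eq0.
  by rewrite (negbTE g_l) (negbTE B_neq0).
move=> /existsNP[o1 /existsNP[r /existsNP[o2 /not_implyP[def_o /contrapT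
  lm_r]]]].
(* Some run [r] is in lm(I). Collecting everything else of [v] into the cofactor [c] shows that [r]
   is a factor of [v]. *)
have size_o1 : (size o1 + (size r + size o2))%N = d.
  by rewrite -size_o def_o !size_cat size_map.
pose c := (a * shm p (omon o1 * shm (size o1 + size r) (omon o2) * shm d (him d
  l)
             * shm d b))%M.
have def_v' : (c * shm (p + size o1) (wd r))%M = wd v.
  rewrite def_v def_l def_o !omon_cat size_map /c; apply: monomP => x k.
  rewrite !shmM !shmD -/(wd r) !monME !addnA; lia.
have [|v1 [v2 [def_v12 size_v1 _]]] := wd_factor def_v';
  first by rewrite size_v; lia.
rewrite def_v12; apply: A_factor.
have [lt_rv|le_vr] := ltnP (size r) (size v); first by apply: IHn => //; lia.
(* If [r] were as long as [v], nothing would be left around it: [o] would be the single run [r],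
   with no letters beyond, and [l] would be a word. *)
case: l_nword; exists r.
  by lia.
have [o1_0 o2_0 p0] : [/\ size o1 = 0%N, size o2 = 0%N & p = 0%N] by split; lia.
have [v1_0 v2_0] : size v1 = 0%N /\ size v2 = 0%N.
  by have := congr1 size def_v12; rewrite !size_cat; split; lia.
have def_vr : v = r.
  by rewrite def_v12 (size0nil v1_0) (size0nil v2_0) cats0.
have omon_o : omon o = wd r.
  by rewrite def_o (size0nil o1_0) (size0nil o2_0) cats0.
have : (a * shm d b * shm d (him d l))%M = 1%M.
  apply: (@mulm_inj X (wd r));
    rewrite mulm1 -{2}def_vr def_v p0 shm0 {2}def_l omon_o.
  apply: monomP => x k; rewrite !monME; lia.
by case/unitm => _ l1; rewrite def_l omon_o l1 mulm1.
Qed.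

End Extension.

Lemma multi_homogeneous_homogeneous (K : fieldType) (X : countType)
    (G : set (lskew K X)) :
  multi_homogeneous G -> homogeneous (G `&` @Rsub K X).
Proof.
move=> G_multi g [Gg Rg]; have [mu [i [p _ def_g]]] := G_multi g Gg.
by exists i; split=> //; exists p.
Qed.

Theorem proposition6p6 (K : fieldType) (X : countType)
    (prec : lskew K X -> lskew K X -> Prop)
    (prec_ordering : monomial_ordering prec)
    (I : set (lskew K X))
    (I_ideal : two_sided_ideal (@Rsub K X) I) (I_graded : graded I)
    (G : set (lskew K X))
    (G_multi_homogeneous : multi_homogeneous G)
    (G_groebner : groebner_basis prec setT (ideal_gen setT I) G) :
  homogeneous (G `&` @Rsub K X) /\
  groebner_basis prec (@Rsub K X) I (G `&` @Rsub K X).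
Proof.
split; first exact: multi_homogeneous_homogeneous.
have GR_I : G `&` @Rsub K X `<=` I.
  move=> g [Gg Rg]; apply:
    (extension_contraction I_ideal I_graded prec_ordering) => //.
  by case: G_groebner => GJ _; apply: GJ.
(* Both generated ideals are intersections, so it suffices that the same ideals [A] of R contain the
   two sets of leading monomials. *)
split=> //; apply/seteqP; split=> w lm_w A [A_ideal lmA]; apply: lm_w;
  split=> // v.
- by move=> [f [GRf f_neq0 lm_f]]; apply: lmA; exists f; split=> //;
    apply: GR_I.
- exact: (lm_ideal_sub I_ideal I_graded prec_ordering G_multi_homogeneous
    G_groebner A_ideal lmA).
Qed.
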